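(* The algebra $\mathfrak g=\mathbb C^*\cdot\mathfrak e_6^{\mathbb C}$, acting on $V\cong\mathbb C^{27}$, is of Ricci-type; that is, the Ricci trace $K(\mathfrak g)\to R(\mathfrak g)$ has zero kernel, so $K(\mathfrak g)\cong R(\mathfrak g)$.
   Context: $V\cong\mathbb C^{27}$ is the standard 27-dimensional representation of the complex simple Lie algebra $\mathfrak e_6^{\mathbb C}$, and $\mathbb C^*\cdot\mathfrak e_6^{\mathbb C}\subset\mathfrak{gl}(V)$ denotes the Lie algebra $\mathbb C\,\mathrm{Id}\oplus\mathfrak e_6^{\mathbb C}$. The space $V$ is regarded as a real vector space with a complex structure, $V^*$ is its real dual, and $\mathfrak g$ is regarded as a real subalgebra of $V^*\otimes_{\mathbb R}V$, consisting of endomorphisms commuting with the complex structure. The formal curvature module is $K(\mathfrak g)=\ker\big(\partial:\wedge^2_{\mathbb R}V^*\otimes_{\mathbb R}\mathfrak g\to\wedge^3_{\mathbb R}V^*\otimes_{\mathbb R}V\big)$, where $\partial$ is antisymmetrisation over the three $V^*$ components; thus $K(\mathfrak g)$ is the space of $\mathfrak g$-valued real 2-forms on $V$ satisfying the first Bianchi identity, and it includes any part of type $(1,1)$ with respect to the complex structure. The Ricci trace sends $k\in K(\mathfrak g)$ to $\mathsf{Ric}(k)\in V^*\otimes_{\mathbb R}V^*$, $\mathsf{Ric}(k)(x,y)=\mathrm{tr}_{\mathbb R}\big(z\mapsto k(x,z)y\big)$, and the formal Ricci-curvature module $R(\mathfrak g)$ is its image. The algebra $\mathfrak g$ is said to be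 of Ricci-type (to have curvature of Ricci-type) if the Ricci trace $K(\mathfrak g)\to R(\mathfrak g)$ has zero kernel, i.e. $K(\mathfrak g)\cong R(\mathfrak g)$. *)

(* Defs.v *)
From HB Require Import structures.
From mathcomp Require Import all_boot all_order all_algebra.
From mathcomp Require Import reals.
From mathcomp Require Import complex.
Set Implicit Arguments.
Unset Strict Implicit.
Unset Printing Implicit Defensive.
Import Order.TTheory GRing.Theory Num.Theory.
Local Open Scope ring_scope.
Local Open Scope complex_scope.

Section LieAlgebras.
Variables (F : fieldType) (L : vectType F) (br : L -> L -> L).

Record is_lie_bracket : Prop := LieBracket {
  lie_linear_l : forall y, linear (br ^~ y);
  lie_linear_r : forall x, linear (br x);
  lie_alternating : forall x, br x x = 0;
  lie_jacobi : forall x y z, br x (br y z) + br y (br z x) + br z (br x y) = 0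
}.

Definition is_lie_subalgebra (U : {vspace L}) : Prop :=
  forall x y, x \in U -> y \in U -> br x y \in U.

Definition is_lie_ideal (U : {vspace L}) : Prop :=
  forall x y, y \in U -> br x y \in U.

Definition is_simple_lie : Prop :=
  (exists x y, br x y != 0) /\
  (forall U : {vspace L}, is_lie_ideal U -> U = 0%VS \/ U = fullv).

Section Representations.
Variables (n : nat) (rho : 'Hom(L, 'M[F]_n)).

(* [L] acts on column vectors by x |-> rho l *m x. *)
Definition is_lie_rep : Prop :=
  forall x y, rho (br x y) = rho x *m rho y - rho y *m rho x.

Definition is_irreducible_rep : Prop :=
  (0 < n)%N /\
  (forall W : {vspace 'cV[F]_n},
     (forall l x, x \in W -> rho l *m x \in W) -> W = 0%VS \/ W = fullv).

End Representations.
End LieAlgebras.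

(* The Dynkin diagram of type E6 in Bourbaki's labelling, shifted to start
   at 0:

       0 - 2 - 3 - 4 - 5
               |
               1                                                          *)
Definition e6_edge (i j : nat) : bool :=
  (i, j) \in [:: (0, 2); (2, 3); (3, 4); (4, 5); (1, 3)]%N.

Definition e6_cartan (i j : 'I_6) : int :=
  if i == j then 2%:Z else if e6_edge i j || e6_edge j i then - 1%:Z else 0.

Section E6.
Variables (F : fieldType) (L : vectType F) (br : L -> L -> L).
Variables (e f h : 'I_6 -> L).

(* Serre's presentation of the Lie algebra with Cartan matrix [e6_cartan]. *)
Record is_e6_chevalley_system : Prop := E6ChevalleySystem {
  e6_hh : forall i j, br (h i) (h j) = 0;
  e6_he : forall i j, br (h i) (e j) = (e6_cartan i j)%:~R *: e j;
  e6_hf : forall i j, br (h i) (f j) = - (e6_cartan i j)%:~R *: f j;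
  e6_ef : forall i j, br (e i) (f j) = if i == j then h i else 0;
  e6_serre_e : forall i j : 'I_6, i != j ->
    iter `|1 - e6_cartan i j|%N (br (e i)) (e j) = 0;
  e6_serre_f : forall i j : 'I_6, i != j ->
    iter `|1 - e6_cartan i j|%N (br (f i)) (f j) = 0;
  e6_generated : forall U : {vspace L}, is_lie_subalgebra br U ->
    (forall i, [/\ e i \in U, f i \in U & h i \in U]) -> U = fullv
}.

(* The representation with highest weight the fundamental weight at the end
   node 0 of a long arm.  Its dual has highest weight the fundamental weight
   at node 5, and the symmetry of the diagram exchanges the two; as the
   Chevalley system is arbitrary, both 27-dimensional irreducible
   representations are covered. *)
Definition is_e6_standard_rep (n : nat) (rho : 'Hom(L, 'M[F]_n)) : Prop :=
  [/\ is_lie_rep br rho, is_irreducible_rep rho &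
      exists2 v : 'cV[F]_n, v != 0 &
        forall i : 'I_6, rho (e i) *m v = 0 /\
                         rho (h i) *m v = (i == ord0)%:R *: v].

End E6.

(* The Lie algebra F Id + rho(L) in gl(F^n). *)
Definition scalars_plus_image (F : fieldType) (L : vectType F) (n : nat)
    (rho : 'Hom(L, 'M[F]_n)) : {vspace 'M[F]_n} :=
  (<[1%:M]> + limg rho)%VS.

Section FormalCurvature.
Variables (R : realType) (n : nat).
Local Notation C := R[i].
Local Notation V := 'cV[C]_n.

Definition real_linear (U W : lmodType C) (phi : U -> W) : Prop :=
  forall (a : R) (x y : U), phi (a%:C *: x + y) = a%:C *: phi x + phi y.

(* The trace over R of an R-linear endomorphism of C^n, in the real basis
   formed by the u_j and the i u_j, where (u_j) is the standard basis. *)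
Definition real_trace (phi : V -> V) : R :=
  \sum_(j < n) (complex.Re (phi (delta_mx j 0) j 0)
                + complex.Im (phi ((0 +i* 1) *: delta_mx j 0) j 0)).

(* K(g): elements of /\^2 V^* (x)_R g are alternating R-bilinear maps
   V x V -> g; being in the kernel of the antisymmetrisation map is the
   first Bianchi identity. *)
Record in_curvature_module (g : {vspace 'M[C]_n}) (k : V -> V -> 'M[C]_n) :
    Prop := InCurvatureModule {
  curv_linear_l : forall y, real_linear (k ^~ y);
  curv_linear_r : forall x, real_linear (k x);
  curv_alternating : forall x, k x x = 0;
  curv_in : forall x y, k x y \in g;
  curv_bianchi : forall x y z, k x y *m z + k y z *m x + k z x *m y = 0
}.

Definition ricci (k : V -> V -> 'M[C]_n) (x y : V) : R :=
  real_trace (fun z => k x z *m y).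

(* R(g) *)
Definition in_ricci_module (g : {vspace 'M[C]_n}) (b : V -> V -> R) : Prop :=
  exists2 k, in_curvature_module g k & b =2 ricci k.

Definition is_ricci_type (g : {vspace 'M[C]_n}) : Prop :=
  forall k, in_curvature_module g k ->
    (forall x y, ricci k x y = 0) -> forall x y, k x y = 0.

(* The Ricci trace is an isomorphism of real vector spaces K(g) -> R(g). *)
Record ricci_trace_iso (g : {vspace 'M[C]_n}) : Prop := RicciTraceIso {
  ricci_linear : forall (a : R) k1 k2,
    in_curvature_module g k1 -> in_curvature_module g k2 ->
    in_curvature_module g (fun x y => a%:C *: k1 x y + k2 x y) /\
    (forall x y, ricci (fun x y => a%:C *: k1 x y + k2 x y) x y
                 = a * ricci k1 x y + ricci k2 x y);
  ricci_maps_to : forall k,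
    in_curvature_module g k -> in_ricci_module g (ricci k);
  ricci_injective : forall k1 k2,
    in_curvature_module g k1 -> in_curvature_module g k2 ->
    ricci k1 =2 ricci k2 -> k1 =2 k2;
  ricci_surjective : forall b, in_ricci_module g b ->
    exists2 k, in_curvature_module g k & ricci k =2 b
}.

End FormalCurvature.

(* Main.v *)
(* The 27 weights of V and the 45 triads of weights with sum zero form the
   generalized quadrangle of the 27 lines on a cubic surface, and g preserves,
   up to scalars, a cubic form N that is a signed sum of the monomials indexed
   by the triads.  Entrywise this says that a matrix of g vanishes between
   distinct collinear weights, that the six entries of a root agree up to sign,
   and that the diagonal has constant sum on the triads.

   For a weight p, the Bianchi identity makes the rows of k(e_p, -) at the
   weights collinear with p symmetric in the two remaining indices, since the
   third term of the identity vanishes there.  These rows carry a quadratic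
   form of rank 10, so the vanishing of the first prolongation of so(10), along
   with relations through common neighbours, expresses all of k by the entries
   k(e_p, e_q)_qy whose sums over q form the Ricci trace, and the same relations
   show that vanishing of these sums forces every such entry to vanish.

   The form k is only real bilinear.  Its part of type (0,2) vanishes by the
   Bianchi identity.  Its part of type (1,1) takes values, for a fixed
   antilinear argument, in the first prolongation of g, and its Ricci trace is
   the trace of these values, so it vanishes because the prolongation has no
   nonzero element with trace-free values. *)
Require Import Defs.
From HB Require Import structures.
From mathcomp Require Import all_boot all_order all_algebra.
From mathcomp Require Import reals.
From mathcomp Require Import complex.
From mathcomp Require Import ring.
Set Implicit Arguments.
Unset Strict Implicit.
Unset Printing Implicit Defensive.
Import Order.TTheory GRing.Theory Num.Theory.
Local Open Scope ring_scope.
Local Open Scope complex_scope.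

(** * The generalized quadrangle of the 27 weights, handled by computation on tables *)

Section Incidence.
Local Open Scope nat_scope.

(* Points number the weights, in the order of [words] below.  The signs are
   forced, up to a common factor, by invariance of the cubic form under the
   lowering operators. *)
Definition positive_triads : seq (seq nat) :=
  [:: [:: 0; 12; 26]; [:: 0; 17; 24]; [:: 0; 21; 22]; [:: 1; 13; 25];
      [:: 1; 18; 23]; [:: 2; 8; 26]; [:: 2; 14; 24]; [:: 2; 19; 20];
      [:: 3; 9; 25]; [:: 3; 16; 21]; [:: 4; 5; 26]; [:: 4; 14; 22];
      [:: 4; 17; 18]; [:: 5; 11; 23]; [:: 5; 15; 20]; [:: 6; 7; 24];
      [:: 6; 13; 19]; [:: 7; 10; 21]; [:: 8; 9; 22]; [:: 8; 15; 16];
      [:: 9; 12; 18]; [:: 10; 11; 17]; [:: 12; 13; 14]].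

Definition negative_triads : seq (seq nat) :=
  [:: [:: 0; 15; 25]; [:: 0; 19; 23]; [:: 1; 10; 26]; [:: 1; 16; 24];
      [:: 1; 20; 22]; [:: 2; 11; 25]; [:: 2; 18; 21]; [:: 3; 6; 26];
      [:: 3; 14; 23]; [:: 3; 17; 20]; [:: 4; 7; 25]; [:: 4; 16; 19];
      [:: 5; 9; 24]; [:: 5; 13; 21]; [:: 6; 11; 22]; [:: 6; 15; 18];
      [:: 7; 8; 23]; [:: 7; 12; 20]; [:: 8; 13; 17]; [:: 9; 10; 19];
      [:: 10; 14; 15]; [:: 11; 12; 16]].

Definition on_triad p q (t : seq nat) := [&& p \in t, q \in t & p != q].

Definition points := iota 0 27.

Definition third_table : seq (seq nat) := Eval vm_compute in
  [seq [seq head 27 [seq x <- flatten (filter (on_triad p q)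
              (positive_triads ++ negative_triads)) | (x != p) && (x != q)]
       | q <- points] | p <- points].

Definition negative_table : seq (seq bool) := Eval vm_compute in
  [seq [seq has (on_triad p q) negative_triads | q <- points] | p <- points].

(* The value 27 stands for "not on a common triad". *)
Definition third p q := nth 27 (nth [::] third_table p) q.
Definition inc p q := third p q < 27.
Definition negative p q := nth false (nth [::] negative_table p) q.

Definition apart p q := ~~ inc p q && (p != q).

Definition all27 (P : pred nat) := all P points.

Lemma all27P (P : pred nat) : all27 P -> forall p, p < 27 -> P p.
Proof. by move=> /allP P27 p ltp; apply: P27; rewrite mem_iota. Qed.

Definition all27_2 (P : nat -> nat -> bool) :=
  all27 (fun p => all27 (fun q => P p q)).

Lemma all27_2P P : all27_2 P -> forall p q, p < 27 -> q < 27 -> P p q.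
Proof. by move=> P27 p q ltp; apply: all27P (all27P P27 ltp) q. Qed.

Lemma inc_lt p q : inc p q -> (p < 27) && (q < 27).
Proof.
rewrite /inc /third => incpq; case: (ltnP p 27) => [ltp|lep]; last first.
  by move: incpq; rewrite [nth [::] _ _]nth_default ?nth_nil.
apply: contraLR incpq; rewrite -!leqNgt => leq.
rewrite nth_default //; apply: leq_trans leq.
by move: p ltp; apply: all27P; vm_compute.
Qed.

Lemma inc_ltl p q : inc p q -> p < 27. Proof. by case/inc_lt/andP. Qed.
Lemma inc_ltr p q : inc p q -> q < 27. Proof. by case/inc_lt/andP. Qed.

(* Implications are spelled with [if], since [vm_compute] evaluates both
   arguments of [==>]. *)
Lemma all27_ifP (C P : pred nat) :
  all27 (fun p => if C p then P p else true) ->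
  forall p, p < 27 -> C p -> P p.
Proof. by move=> P27 p ltp Cp; have := all27P P27 ltp; rewrite /= Cp. Qed.

Lemma all_incP (P : nat -> nat -> bool) :
  all27_2 (fun p q => if inc p q then P p q else true) ->
  forall p q, inc p q -> P p q.
Proof.
move=> P27 p q ipq; have /andP[ltp ltq] := inc_lt ipq.
exact: all27_ifP (all27P P27 ltp) q ltq ipq.
Qed.

Lemma all_apartP (P : nat -> nat -> bool) :
  all27_2 (fun p q => if apart p q then P p q else true) ->
  forall p q, p < 27 -> q < 27 -> apart p q -> P p q.
Proof. by move=> P27 p q ltp; apply: all27_ifP (all27P P27 ltp) q. Qed.

Lemma inc_sym p q : inc p q = inc q p.
Proof.
have sym: forall a b, inc a b -> inc b a by apply: all_incP; vm_compute.
by apply/idP/idP; apply: sym.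
Qed.

Lemma third_sym p q : inc p q -> third q p = third p q.
Proof.
move=> /(all_incP (P := fun p q => third q p == third p q)) H.
by apply/eqP/H; vm_compute.
Qed.

Lemma inc_third p q : inc p q -> inc p (third p q).
Proof. by move: p q; apply: all_incP; vm_compute. Qed.

Lemma thirdK p q : inc p q -> third p (third p q) = q.
Proof.
move=> /(all_incP (P := fun p q => third p (third p q) == q)) H.
by apply/eqP/H; vm_compute.
Qed.

Lemma inc_third_r p q : inc p q -> inc q (third p q).
Proof. by move=> ipq; rewrite -third_sym // inc_third // inc_sym. Qed.

Lemma inc_neq p q : inc p q -> p != q.
Proof. by move: p q; apply: all_incP; vm_compute. Qed.

Lemma negative_sym p q : inc p q -> negative q p = negative p q.
Proof.
move=> /(all_incP (P := fun p q => negative q p == negative p q)) H.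
by apply/eqP/H; vm_compute.
Qed.

Lemma negative_third p q : inc p q -> negative p (third p q) = negative p q.
Proof.
move=> /(all_incP (P := fun p q => negative p (third p q) == negative p q)) H.
by apply/eqP/H; vm_compute.
Qed.

(** A generalized quadrangle has no triangles apart from its lines. *)
Lemma inc_triad p q r :
  inc p q -> inc p r -> inc q r -> r = third p q.
Proof.
move=> ipq ipr iqr; apply/eqP; move: p q ipq r ipr iqr => p q ipq r ipr.
have /implyP := all27P (all_incP (P := fun p q => all27 (fun r =>
  (inc p r && inc q r) ==> (r == third p q))) (erefl true) ipq) (inc_ltr ipr).
by rewrite ipr; apply.
Qed.

End Incidence.

Lemma incxx p : inc p p = false.
Proof. by apply/negP => /inc_neq; rewrite eqxx. Qed.

Lemma apart_sym p q : apart p q = apart q p.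
Proof. by rewrite /apart inc_sym eq_sym. Qed.

Lemma apart_triad p q r : inc p q -> inc p r -> r != q -> r != third p q ->
  apart q r.
Proof.
move=> ipq ipr rq rt; rewrite /apart eq_sym rq andbT.
by apply: contra rt => iqr; apply/eqP/inc_triad.
Qed.

Lemma apart_neq_third p q r : inc p q -> apart q r -> r != third p q.
Proof.
by move=> ipq /andP[nqr _]; apply: contra nqr => /eqP ->; apply: inc_third_r.
Qed.

(** Distinct triads through [p] are not linked away from [p], as there are no triangles. *)
Lemma apart_third p q r : inc p q -> inc p r -> apart q r -> apart (third p q) r.
Proof.
move=> ipq ipr sqr; apply: (apart_triad (p := p)); rewrite ?inc_third ?thirdK //.
  exact: apart_neq_third sqr.
by case/andP: sqr => _; rewrite eq_sym.
Qed.


Lemma neighbour p : (p < 27)%N -> exists q, inc p q.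
Proof.
move=> ltp; suff /hasP[q _ ipq] : has (inc p) points by exists q.
by move: p ltp; apply: all27P; vm_compute.
Qed.

(** Provides the centre [p] at which [prolongation_trace_free] uses the lemmas on symmetric rows. *)
Lemma common_neighbour p q r :
    (p < 27)%N -> (q < 27)%N -> (r < 27)%N -> apart p q -> apart p r ->
  exists m, [/\ inc m p, inc m q & inc m r].
Proof.
move=> ltp ltq ltr spq spr.
pose meets r m := [&& inc m p, inc m q & inc m r].
suff /hasP[m _ /and3P[imp imq imr]] : has (meets r) points by exists m.
apply: (all27_ifP (C := apart p) (P := fun r => has (meets r) points) _ ltr spr).
rewrite {}/meets {ltr r spr}.
by move: p q ltp ltq spq; apply: all_apartP; vm_compute.
Qed.

(** The axiom of a generalized quadrangle: a point off a line is collinear with exactly one point of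
    it. *)
Lemma inc_third_apart p q z : (z < 27)%N -> inc p q -> apart p z -> apart q z ->
  inc (third p q) z.
Proof.
move=> ltz ipq spz sqz.
apply: (all27_ifP (C := fun z => apart p z && apart q z)
          (P := inc (third p q)) _ ltz); last by rewrite spz.
by move: p q ipq {ltz spz sqz}; apply: all_incP; vm_compute.
Qed.

(** * Entrywise invariance and the first prolongation *)

Section TriadInvariance.
Variable F : numFieldType.

Definition sgn p q : F := (-1) ^+ negative p q.

Lemma sgn_sym p q : inc p q -> sgn q p = sgn p q.
Proof. by move=> ipq; rewrite /sgn negative_sym. Qed.

Lemma sgn_third p q : inc p q -> sgn p (third p q) = sgn p q.
Proof. by move=> ipq; rewrite /sgn negative_third. Qed.

Lemma sgnK p q : sgn p q * sgn p q = 1.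
Proof. by rewrite -expr2 sqrr_sign. Qed.

(* The entrywise form of [A.N = l N], for the cubic form [N] that is the sum
   of [+- x_a x_b x_c] over the triads. *)
Record triad_invariant (l : F) (A : nat -> nat -> F) : Prop := TriadInvariant {
  entry_inc : forall r s, inc r s -> A r s = 0;
  entry_cross : forall m r s, inc m r -> inc m s -> apart r s ->
    A r s = - (sgn m r * sgn m s * A (third m s) (third m r));
  diag_triad : forall p q, inc p q ->
    A p p + A q q + A (third p q) (third p q) = l
}.

Lemma trace_triad_invariant l A : triad_invariant l A ->
  \sum_(r < 27) A r r = 9%:R * l.
Proof.
move=> /diag_triad D.
pose triad a b c := A a a + A b b + A c c.
rewrite -(big_mkord xpredT (fun r => A r r)) unlock /=.
(* These nine triads form a spread: they partition the 27 points. *)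
transitivity (triad 0 12 26 + triad 1 13 25 + triad 2 14 24 + triad 3 16 21
  + triad 4 17 18 + triad 5 15 20 + triad 6 11 22 + triad 7 8 23
  + triad 9 10 19); first by rewrite /triad; ring.
have Dt a b c : inc a b -> third a b = c -> triad a b c = l.
  by move=> iab <-; apply: D.
by rewrite !Dt //; ring.
Qed.

Section SymmetricRows.
Variables (p : nat) (T : nat -> nat -> nat -> F) (l : nat -> F).
Hypothesis T_inv : forall q, triad_invariant (l q) (T q).
Hypothesis T_sym : forall q r s, inc p r -> T q r s = T s r q.

(* The ten points collinear with [p] carry the quadratic form
   [N(e_p, -, -)]; this is the vanishing of the first prolongation of its
   orthogonal Lie algebra. *)
Lemma symmetric_rows_off_diag q r s :
  inc p q -> inc p r -> inc p s -> r != q -> r != s -> s != third p q ->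
  T q r s = 0.
Proof.
move=> ipq ipr ips rq rs sq'.
have [rq'|rq'] := eqVneq r (third p q).
  by rewrite T_sym // (entry_inc (T_inv s)) // rq' inc_sym inc_third_r.
have sqr : apart q r by apply: (apart_triad (p := p)).
have srq : apart r q by rewrite apart_sym.
have Trs : T q r s
    = - (sgn p r * sgn p q * T (third p r) (third p q) s).
  by rewrite T_sym // (entry_cross (T_inv s) ipr ipq) // [T s _ _]T_sym ?inc_third.
have [sq|sq] := eqVneq s q.
  rewrite Trs (entry_inc (T_inv _)) ?mulr0 ?oppr0 //.
  by rewrite sq inc_sym inc_third_r.
have sqs : apart q s by apply: (apart_triad (p := p)).
have Tqs : T (third p r) (third p q) s
    = - (sgn p q * sgn p s * T q (third p s) (third p r)).
  rewrite (entry_cross (T_inv _) (inc_third ipq) ips) ?apart_third //.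
  by rewrite thirdK // sgn_third // [T (third p r) _ _]T_sym ?inc_third.
have [rs'|rs'] := eqVneq r (third p s).
  by rewrite (entry_inc (T_inv q)) // rs' inc_sym inc_third_r.
have ssr : apart s r by apply: (apart_triad (p := p)).
have Tsr : T q (third p s) (third p r) = - (sgn p s * sgn p r * T q r s).
  rewrite (entry_cross (T_inv _) (inc_third ips) (inc_third ipr)).
    by rewrite !thirdK // !sgn_third.
  rewrite apart_third ?inc_third // apart_sym.
  by rewrite apart_third // apart_sym.
(* Alternating the symmetry of [T] with the crossing over [p] returns to the initial entry after
   three changes of sign, and every [sgn] occurs squared. *)
apply/eqP; rewrite -eqNr; apply/eqP; rewrite {2}Trs Tqs Tsr.
rewrite -[LHS]mul1r -(sgnK p q) -[LHS]mul1r -(sgnK p r) -[LHS]mul1r -(sgnK p s).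
ring.
Qed.

(** Two crossings over [p], with the symmetry of the rows in between, lead from [r] to its partner
    [third p r]; each sign occurs twice. *)
Lemma symmetric_rows_diag q r : inc p q -> inc p r -> apart q r ->
  T q r r = T q (third p r) (third p r).
Proof.
move=> ipq ipr sqr; have srq : apart r q by rewrite apart_sym.
rewrite T_sym // (entry_cross (T_inv r) ipr ipq) // [T r _ _]T_sym ?inc_third //.
rewrite (entry_cross (T_inv _) (inc_third ipq) ipr) ?apart_third //.
rewrite thirdK // sgn_third // [T _ _ q]T_sym ?inc_third //.
rewrite mulrN opprK mulrACA -[LHS]mul1r -[RHS]mul1r -(sgnK p q) -[RHS]mul1r.
by rewrite -(sgnK p r); ring: (sgnK p q) (sgnK p r).
Qed.

End SymmetricRows.

Lemma two_eq0 (x : F) : x + x = 0 -> x = 0.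
Proof. by move=> xx; apply/eqP; rewrite -eqNr eq_sym -addr_eq0 xx. Qed.

(** Exchanging [q] and [s] produces entries between collinear points, which vanish. Triad sums then
    kill the diagonal, and the other entries are treated at a common neighbour of the three
    indices. *)
Lemma prolongation_trace_free (T : nat -> nat -> nat -> F) :
    (forall q, triad_invariant 0 (T q)) ->
    (forall q r s, T q r s = T s r q) ->
  forall q r s, (q < 27)%N -> (r < 27)%N -> (s < 27)%N -> T q r s = 0.
Proof.
move=> T_inv T_sym.
have T_diag q r : (q < 27)%N -> (r < 27)%N -> T q r r = 0.
  move=> ltq ltr; have [iqr|niqr] := boolP (inc q r).
    by rewrite T_sym (entry_inc (T_inv r)) // inc_sym.
  have [->|qr] := eqVneq q r.
    have [p ipr] := neighbour ltr.
    have := diag_triad (T_inv r) ipr.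
    rewrite (T_sym r p p) (T_sym r (third r p)).
    rewrite (entry_inc (T_inv p)) 1?inc_sym // addr0.
    by rewrite (entry_inc (T_inv (third r p))) ?addr0 // inc_sym inc_third.
  have sqr : apart q r by rewrite /apart niqr qr.
  have [p [ipq ipr _]] := common_neighbour ltq ltr ltr sqr sqr.
  have := diag_triad (T_inv q) ipr.
  rewrite (T_sym q p p) (entry_inc (T_inv p)) // add0r.
  rewrite -(symmetric_rows_diag (p := p) T_inv) //.
  exact: two_eq0.
move=> q r s ltq ltr lts; have [irs|nirs] := boolP (inc r s).
  exact: entry_inc (T_inv q) _ _ irs.
have [iqr|niqr] := boolP (inc q r).
  by rewrite T_sym (entry_inc (T_inv s)) // inc_sym.
have [->|rs] := eqVneq r s; first exact: T_diag.
have [<-|qr] := eqVneq q r; first by rewrite T_sym T_diag.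
have sqr : apart q r by rewrite /apart niqr qr.
have srs : apart r s by rewrite /apart nirs rs.
have [p [ipr ipq ips]] : exists m, [/\ inc m r, inc m q & inc m s].
  by apply: common_neighbour; rewrite // apart_sym.
(* When [s] is the partner of [q], crossing over [p] moves the entry to row [q], and exchanging the
   outer indices makes it diagonal. *)
have [->|sq'] := eqVneq s (third p q); last first.
  by apply: (symmetric_rows_off_diag (p := p) T_inv); rewrite // eq_sym.
rewrite (entry_cross (T_inv q) ipr (inc_third ipq)) ?thirdK //.
  rewrite T_sym T_diag ?mulr0 ?oppr0 //; exact: inc_ltr (inc_third ipr).
by rewrite apart_sym apart_third // apart_sym.
Qed.

End TriadInvariance.

(** * Ricci-flat complex bilinear curvature, first at collinear pairs *)

Section RicciFlat.
Variables (F : numFieldType) (K : nat -> nat -> nat -> nat -> F).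
Local Notation sgn := (sgn F).
Hypothesis K_anti : forall p q r s, K p q r s = - K q p r s.
Hypothesis K_bianchi : forall p q s r,
  K p q r s + K q s r p + K s p r q = 0.
Hypothesis K_trinv : forall p q, exists l, triad_invariant l (K p q).
Hypothesis K_ricci : forall p y, \sum_(z < 27) K p z z y = 0.

Lemma curv_diag0 p r s : K p p r s = 0.
Proof. by apply: two_eq0; rewrite {1}K_anti addNr. Qed.

(** Contracting the Bianchi identity expresses the trace of [K p q], which is nine times the
    constant, by two Ricci traces. *)
Lemma curv_trace_free p q : triad_invariant 0 (K p q).
Proof.
have [l K_l] := K_trinv p q; suff <- : l = 0 by [].
have: \sum_(r < 27) (K p q r r + K q r r p + K r p r q) = 0.
  by apply: big1 => r _; apply: K_bianchi.
rewrite !big_split /= (trace_triad_invariant K_l) K_ricci addr0.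
rewrite [X in _ + X](_ : _ = 0); last first.
  under eq_bigr do rewrite K_anti.
  by rewrite sumrN K_ricci oppr0.
by rewrite addr0 => /eqP; rewrite mulf_eq0 pnatr_eq0 => /eqP.
Qed.

Let K_inv p := curv_trace_free p.

Lemma curv_rows p q r s : inc p r -> K p q r s = K p s r q.
Proof.
move=> ipr; have := K_bianchi p q s r.
rewrite (entry_inc (K_inv q s)) 1?inc_sym // addr0 [K s p _ _]K_anti.
by move/subr0_eq.
Qed.

(** The symmetry of row [r] moves the entry to column [q], collinear with [r]. *)
Lemma curv_two_rows p q r s : inc p r -> inc q r -> K p q r s = 0.
Proof.
move=> ipr iqr; rewrite curv_rows // (entry_inc (K_inv p s)) //.
by rewrite inc_sym.
Qed.

Lemma curv_inc_sym p q : inc p q -> K p q q q = K q p p p.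
Proof.
move=> ipq; have := diag_triad (K_inv p q) ipq.
rewrite (curv_two_rows (r := third p q)) ?inc_third ?inc_third_r // addr0.
by rewrite [K p q p p]K_anti addrC => /subr0_eq.
Qed.

(** The diagonal entries at [r] and [third p r] agree, so each is half of what the triad through [p]
    leaves. *)
Lemma curv_inc_diag p q r : inc p q -> inc p r -> apart q r ->
  K p q r r = K p q q q / 2%:R.
Proof.
move=> ipq ipr sqr; have := diag_triad (K_inv p q) ipr.
rewrite -(symmetric_rows_diag (p := p) (K_inv p)) //; last first.
  by move=> *; apply: curv_rows.
rewrite [K p q p p]K_anti -curv_inc_sym // -addrA addrC.
by move/subr0_eq <-; rewrite -mulr2n -[_ *+ 2]mulr_natr mulfK ?pnatr_eq0.
Qed.

Lemma curv_inc_row p q r : inc p q -> inc p r -> apart q r ->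
  K p r r q = K p q q q / 2%:R.
Proof. by move=> ipq ipr sqr; rewrite -curv_rows // curv_inc_diag. Qed.

(* The triads on the sides of the hexagon [p c z b a q] carry six signs with
   product -1; the roots [z - q], [a - c] and [p - b] coincide. *)
Definition hexagon p q z c :=
  let t := third p q in let b := third t z in
  let m := third z c in let a := third m q in let m' := third p c in
  [&& inc p c, inc z c, apart q c, apart b c & inc m q] &&
  [&& inc m' b, third m' b == a, apart a z & apart a p] &&
  (negative m q (+) negative m z (+) negative m' b (+) negative m' p
   (+) negative t p (+) negative t z).

Lemma hexagon_exists p q z : (z < 27)%N -> inc p q -> apart z p && apart z q ->
  exists c, hexagon p q z c.
Proof.
move=> ltz ipq sz; suff /hasP[c _ Wc] : has (hexagon p q z) points.
  by exists c.
apply: (all27_ifP (C := fun z => apart z p && apart z q)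
          (P := fun z => has (hexagon p q z) points) _ ltz sz).
by move: p q ipq {ltz sz}; apply: all_incP; vm_compute.
Qed.

(* The root is moved across [m] and back, so that the signs cancel. *)
Lemma curv_cross_row p c z s : let m := third z c in
  inc p c -> inc z c -> inc m s -> inc p (third m s) -> apart z s ->
  K p z z s = K p c c s.
Proof.
move=> m ipc izc ims ipa szs.
have imz : inc m z by rewrite inc_sym inc_third.
have mz : third m z = c by rewrite third_sym ?thirdK // inc_third.
rewrite (entry_cross (K_inv p z) imz ims) // mz curv_rows //.
rewrite (entry_cross (K_inv p c) (inc_third ims) imz) ?apart_third //; last first.
  by rewrite apart_sym.
rewrite mz thirdK // sgn_third // mulrN opprK mulrA.
by rewrite mulrACA [sgn m s * _]mulrC mulrACA !sgnK mulr1 mul1r.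
Qed.

(** A crossing over [m] leads to [K p z a c], which the Bianchi identity splits into entries of
    [K p c] and [K z c]. Both pairs are collinear, and crossing over [m] and [m'] gives rows known
    from [curv_inc_row]. *)
Lemma curv_inc_apart p q z : (z < 27)%N -> inc p q -> apart z p -> apart z q ->
  let t := third p q in
  sgn t p * K p z z q = (sgn t p * K p q q q
    + sgn t z * K z (third t z) (third t z) (third t z)) / 2%:R.
Proof.
move=> ltz ipq szp szq t.
have [|c] := hexagon_exists ltz ipq; first by rewrite szp.
rewrite /hexagon -/t; set b := third t z; set m := third z c.
set a := third m q; set m' := third p c.
case/andP=> /andP[/and5P[ipc izc sqc sbc imq] /and4P[im'b /eqP ab saz sap]] sg.
have izb : inc z b.
  by apply: inc_third_r; rewrite inc_third_apart // apart_sym.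
have imz : inc m z by rewrite inc_sym inc_third.
have mz : third m z = c by rewrite third_sym ?thirdK // inc_third.
have im'p : inc m' p by rewrite inc_sym inc_third.
have m'p : third m' p = c by rewrite third_sym ?thirdK // inc_third.
rewrite (entry_cross (K_inv p z) imz imq) // mz -/a.
have -> : K p z a c = K p c a z - K z c a p.
  have := K_bianchi p z c a; rewrite [K c p _ _]K_anti => /eqP.
  by rewrite -addrA addr_eq0 opprB => /eqP.
rewrite (entry_cross (K_inv p c) (inc_third imq) imz) //.
rewrite mz thirdK // sgn_third // [K p c c q]curv_inc_row //.
rewrite (entry_cross (K_inv z c) (m := m') (r := a) (s := p)) //; last first.
  by rewrite -ab inc_third.
rewrite m'p -ab thirdK // sgn_third // [K z c c b]curv_inc_row //.
have sg6 : sgn m q * sgn m z * sgn m' b * sgn m' p * sgn t p * sgn t z = -1.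
  by rewrite -!signr_addb sg expr1.
move: sg6 (sgnK F m q) (sgnK F m z) (sgnK F t p) (sgnK F t z).
move: (sgn m q) (sgn m z) (sgn m' b) (sgn m' p) (sgn t p) (sgn t z).
move: (K p q q q) (K z b b b) => x y a1 a2 a3 a4 a5 a6 e6 e1 e2 e5 e6'.
(* The last summand is zero because [a6] is a sign; it is added to make the product of all six signs
   appear. *)
have -> : a5 * - (a2 * a1 * (- (a1 * a2 * (x / 2%:R)) - - (a3 * a4 * (y / 2%:R))))
  = (a1 * a1) * (a2 * a2) * a5 * (x / 2%:R)
    - (a1 * a2 * a3 * a4 * a5 * a6) * a6 * (y / 2%:R)
    + (a6 * a6 - 1) * (a1 * a2 * a3 * a4 * a5 * (y / 2%:R)).
  by ring.
rewrite e6 e1 e2 e6'; ring.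
Qed.

(** For fixed [t], these are the unknowns of a linear system indexed by the neighbours of [t]. With
    this sign the right side of [curv_inc_apart] is the mean of [psi t p] and [psi t z]. *)
Let psi t z := sgn t z * K z (third t z) (third t z) (third t z).

Lemma psi_third t z : inc t z -> psi t (third t z) = psi t z.
Proof.
move=> itz; rewrite /psi sgn_third // thirdK //.
by rewrite [in RHS]curv_inc_sym // inc_third_r.
Qed.

(** The correction at [p] and [q] on the left, and the coefficient 2 at [q], make one formula valid
    for all [z], ready to be summed. *)
Lemma ricci_entry t p z : (z < 27)%N -> inc t p -> let q := third t p in
  sgn t p * K p z z q + ((z == p) + (z == q))%:R * (psi t p / 2%:R)
  = (if z == q then 2%N else apart z q)%:R * (psi t p / 2%:R)
    + (inc t z)%:R * (psi t z / 2%:R).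
Proof.
move=> ltz itp q; have ipq : inc p q by apply: inc_third_r.
have pq := inc_neq ipq.
have [->|zp] := eqVneq z p.
  by rewrite curv_diag0 (negPf pq) itp /apart ipq /=; ring.
have [->|zq] := eqVneq z q.
  by rewrite psi_third // inc_third // /psi -/q /=; field.
have [izq|nizq] := boolP (inc z q).
  rewrite (entry_inc (K_inv p z)) // /apart izq /=.
  have -> : inc t z = false.
    apply/negP => itz; case/negP: zp; apply/eqP.
    by rewrite (inc_triad (inc_third itp) itz) 1?inc_sym // thirdK.
  by rewrite /=; ring.
have szq : apart z q by rewrite /apart nizq.
have [ipz|nipz] := boolP (inc p z).
  rewrite [K p z z q]curv_inc_row //; last by rewrite apart_sym.
  have -> : inc t z = false.
    apply/negP => itz; case/negP: zq; apply/eqP.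
    by rewrite (inc_triad itp itz).
  by rewrite szq /psi -/q /=; ring.
have szp : apart z p by rewrite /apart inc_sym nipz.
have qt : third p q = t by rewrite /q (third_sym (p := p)) ?thirdK // inc_sym.
have itz : inc t z by rewrite -qt inc_third_apart // apart_sym.
have := curv_inc_apart ltz ipq szp szq; rewrite qt itz szq => ->.
rewrite /psi -/q /=.
by field.
Qed.

Lemma sum_points (f : nat -> nat) :
  \sum_(z < 27) (f z)%:R = (sumn [seq f z | z <- points])%:R :> F.
Proof. by rewrite -natr_sum -(big_mkord xpredT) sumnE big_map. Qed.

Lemma count_triad p q : inc p q ->
  sumn [seq ((z == p) + (z == q))%N | z <- points] = 2%N /\
  sumn [seq if z == q then 2%N else apart z q | z <- points] = 18%N.
Proof.
move=> ipq; suff /andP[/eqP-> /eqP->] :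
    (sumn [seq ((z == p) + (z == q))%N | z <- points] == 2%N) &&
    (sumn [seq if z == q then 2%N else apart z q : nat | z <- points] == 18%N).
  by [].
by move: p q ipq; apply: all_incP; vm_compute.
Qed.

(** The Ricci sum at [p] and [third t p]: the coefficient is 18, from the 16 points apart from
    [third t p] and that point counted twice, less 2 for the correction. *)
Lemma psi_sum t p : inc t p ->
  16%:R * psi t p + \sum_(z < 27) (inc t z)%:R * psi t z = 0.
Proof.
move=> itp; have ipq : inc p (third t p) by apply: inc_third_r.
set q := third t p in ipq.
have: \sum_(z < 27) (sgn t p * K p z z q
      + ((z == p :> nat) + (z == q :> nat))%:R * (psi t p / 2%:R))
    = \sum_(z < 27) ((if z == q :> nat then 2%N else apart z q)%:R
      * (psi t p / 2%:R) + (inc t z)%:R * (psi t z / 2%:R)).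
  by apply: eq_bigr => z _; apply: ricci_entry.
rewrite !big_split /= -mulr_sumr K_ricci mulr0 add0r -!mulr_suml.
rewrite (sum_points (fun z => (z == p) + (z == q))%N).
rewrite (sum_points (fun z => if z == q then 2%N else apart z q)).
have [-> ->] := count_triad ipq.
move=> e2; have e : 2%:R * psi t p = 18%:R * psi t p
    + \sum_(z < 27) (inc t z)%:R * psi t z.
  apply: (mulIf (x := 2%:R^-1)); first by rewrite invr_eq0 pnatr_eq0.
  rewrite [RHS]mulrDl -!(mulrA _ (psi t p)) e2 mulr_suml; congr (_ + _).
  by apply: eq_bigr => z _; rewrite mulrA.
by apply: (addrI (2%:R * psi t p)); rewrite addr0 {2}e; ring.
Qed.

(** Adding [psi_sum] over the ten neighbours of [t] gives [(16 + 10) S = 0]; then each [psi t p]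
    vanishes. *)
Lemma curv_inc_zero p q : inc p q -> K p q q q = 0.
Proof.
move=> ipq; set t := third p q.
have itp : inc t p by rewrite inc_sym inc_third.
have qE : third t p = q by rewrite third_sym ?inc_third // thirdK.
suff /eqP : psi t p = 0.
  by rewrite mulf_eq0 signr_eq0 qE => /eqP.
pose S := \sum_(z < 27) (inc t z)%:R * psi t z.
have count10 : sumn [seq (inc t z : nat) | z <- points] = 10%N.
  apply/eqP; apply: (all27P (P := fun t =>
    sumn [seq (inc t z : nat) | z <- points] == 10%N) _ (inc_ltl itp)).
  by vm_compute.
have : \sum_(z < 27) (inc t z)%:R * (16%:R * psi t z + S) = 0.
  apply: big1 => z _; have [itz|_] := boolP (inc t z); last exact: mul0r.
  by rewrite psi_sum ?mulr0.
under eq_bigr do rewrite mulrDr mulrCA.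
rewrite big_split /= -mulr_sumr -mulr_suml -/S (sum_points (fun z => inc t z)) count10.
rewrite -mulrDl -natrD => /eqP; rewrite mulf_eq0 pnatr_eq0 /= => /eqP S0.
have := psi_sum itp; rewrite -/S S0 addr0 => /eqP.
by rewrite mulf_eq0 pnatr_eq0 => /eqP.
Qed.

(** * Pairs that are not collinear, and the summands of the Ricci trace *)

Lemma curv_apart_diag p s q : (s < 27)%N -> inc p q -> apart p s ->
  apart q s -> K p s q q = - K p s p p.
Proof.
move=> lts ipq sps sqs; have ist : inc s (third p q) by rewrite inc_sym inc_third_apart.
have := diag_triad (K_inv p s) ipq.
rewrite [K p s (third p q) _]curv_two_rows ?inc_third // addr0.
by rewrite addrC => /eqP; rewrite addr_eq0 => /eqP.
Qed.

Lemma curv_apart_diag2 p s q : (p < 27)%N -> inc s q -> apart p s ->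
  apart q p -> K p s q q = - K p s s s.
Proof.
move=> ltp isq sps sqp; rewrite [LHS]K_anti curv_apart_diag // 1?apart_sym //.
by rewrite -K_anti.
Qed.

(* Such an [x] is collinear with neither [p] nor [s], and its diagonal entry
   is determined by those at [u] and [v]. *)
Definition far_line p s x u :=
  let v := third x u in
  [&& inc x u, inc p u, apart u s, inc s v & apart v p].

Definition far_point p s x := has (far_line p s x) [seq u <- points | inc p u].

Definition far_pair p s x :=
  if far_point p s x then
    has (fun r => if inc r x then far_point p s (third r x) else false)
      [seq r <- points | inc p r && inc s r]
  else false.

Lemma far_pair_exists p s : (p < 27)%N -> (s < 27)%N -> apart p s ->
  exists x, far_pair p s x.
Proof.
move=> ltp lts sps; suff /hasP[x _ Wx] : has (far_pair p s) points.
  by exists x.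
by move: p s ltp lts sps; apply: all_apartP; vm_compute.
Qed.

(** The diagonal entry at a far point is the sum of those at [p] and [s]. A triad of two far points
    and a common neighbour of [p] and [s], where the entry is zero, makes twice this sum vanish. *)
Lemma curv_apart_sym p s : (p < 27)%N -> (s < 27)%N -> apart p s ->
  K p s s s = - K p s p p.
Proof.
move=> ltp lts sps.
have diag x : far_point p s x -> K p s x x = K p s p p + K p s s s.
  rewrite /far_point => /hasP[u _ /and5P[ixu ipu sus isv svp]].
  have := diag_triad (K_inv p s) ixu.
  rewrite (curv_apart_diag lts ipu) // (curv_apart_diag2 ltp isv) //.
  by move/eqP; rewrite -addrA -opprD subr_eq0 => /eqP.
have [x] := far_pair_exists ltp lts sps; rewrite /far_pair.
case: ifP => // Wx /hasP[r]; rewrite mem_filter => /andP[/andP[ipr isr] _].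
case: ifP => // irx Wy.
have := diag_triad (K_inv p s) irx.
rewrite curv_two_rows // add0r (diag _ Wx) (diag _ Wy) => /two_eq0/eqP.
by rewrite addrC addr_eq0 => /eqP.
Qed.

Lemma curv_apart_row_inc p s q : (p < 27)%N -> (s < 27)%N -> apart p s ->
  inc p q -> apart q s -> K p q q s = K p s s s.
Proof.
by move=> *; rewrite -curv_rows // curv_apart_diag // curv_apart_sym.
Qed.

(** Through [c], [curv_cross_row] moves the contracted index from [z] to a neighbour of [p], where
    [curv_apart_row_inc] applies. *)
Definition detour p s z c :=
  let m := third z c in
  [&& inc p c, inc z c, apart c s, inc m s & inc p (third m s)].

Lemma detour_exists p s z : (p < 27)%N -> (s < 27)%N -> (z < 27)%N ->
  apart p s -> apart p z && apart z s -> exists c, detour p s z c.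
Proof.
move=> ltp lts ltz sps sz; suff /hasP[c _ Wc] : has (detour p s z) points.
  by exists c.
apply: (all27_ifP (C := fun z => apart p z && apart z s)
          (P := fun z => has (detour p s z) points) _ ltz sz).
by move: p s ltp lts sps {ltz sz}; apply: all_apartP; vm_compute.
Qed.

Lemma curv_apart_row p s z : (p < 27)%N -> (s < 27)%N -> (z < 27)%N ->
  apart p s -> z != p -> ~~ inc z s -> K p z z s = K p s s s.
Proof.
move=> ltp lts ltz sps zp nizs.
have [->//|zs] := eqVneq z s.
have szs : apart z s by rewrite /apart nizs.
have [ipz|nipz] := boolP (inc p z); first exact: curv_apart_row_inc.
have spz : apart p z by rewrite /apart nipz eq_sym.
have [|c /and5P[ipc izc scs ims ipa]] := detour_exists ltp lts ltz sps.
  by rewrite spz.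
by rewrite (curv_cross_row ipc izc) // curv_apart_row_inc.
Qed.

(** The Ricci sum reduces to 16 equal terms by [curv_apart_row]. *)
Lemma curv_apart_zero p s : (p < 27)%N -> (s < 27)%N -> apart p s ->
  K p s s s = 0.
Proof.
move=> ltp lts sps; have := K_ricci p s.
rewrite (eq_bigr (fun z : 'I_27 =>
  ((z != p :> nat) && ~~ inc z s)%:R * K p s s s)) => [|z _].
  rewrite -mulr_suml (sum_points (fun z => (z != p) && ~~ inc z s)).
  suff -> : sumn [seq ((z != p) && ~~ inc z s : nat) | z <- points] = 16%N.
    by move/eqP; rewrite mulf_eq0 pnatr_eq0 => /eqP.
  by apply/eqP; move: p s ltp lts sps; apply: all_apartP; vm_compute.
have [->|zp] := eqVneq (z : nat) p; first by rewrite curv_diag0 mul0r.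
have [izs|nizs] := boolP (inc z s); last by rewrite mul1r curv_apart_row.
by rewrite (entry_inc (K_inv p z)) // mul0r.
Qed.

(** A crossing over [third z w], which is collinear with [p], leads to a symmetric row. Its symmetry
    exchanges [z] and [w], and a second crossing leads back. *)
Lemma curv_return_inc p z w : (p < 27)%N -> apart p z -> apart p w ->
  inc z w -> K p z z p = K p w w p.
Proof.
move=> ltp spz spw izw; have imp : inc (third z w) p.
  by apply: inc_third_apart; rewrite // apart_sym.
have imw : inc (third z w) w by rewrite inc_sym inc_third_r.
have imz : inc (third z w) z by rewrite inc_sym inc_third.
have mz : third (third z w) z = w by rewrite third_sym ?thirdK // inc_third.
rewrite (entry_cross (K_inv p z) imz imp) ?mz; last by rewrite apart_sym.
rewrite curv_rows ?inc_third_r //.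
rewrite (entry_cross (K_inv p w) (inc_third imp) imz) ?apart_third //.
rewrite mz thirdK // sgn_third // mulrN opprK mulrA.
by rewrite mulrACA [sgn _ p * _]mulrC mulrACA !sgnK mulr1 mul1r.
Qed.

(** Joined by a path of length at most two; the graph on the 16 points apart from [p] has diameter
    two. *)
Definition linked p z w :=
  [|| z == w, inc z w | has (fun v => [&& inc z v, inc v w & apart p v]) points].

Lemma curv_return p z w : (p < 27)%N -> (z < 27)%N -> (w < 27)%N ->
  apart p z -> apart p w -> K p z z p = K p w w p.
Proof.
move=> ltp ltz ltw spz spw.
have : linked p z w.
  apply: (all27_ifP (C := apart p) (P := linked p z) _ ltw spw).
  by move: p z ltp ltz spz {spw}; apply: all_apartP; vm_compute.
case/or3P => [/eqP->//|izw|/hasP[v _ /and3P[izv ivw spv]]].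
  exact: curv_return_inc.
by rewrite (curv_return_inc ltp spz spv) // (curv_return_inc ltp spv spw).
Qed.

Lemma curv_return_zero p z : (p < 27)%N -> (z < 27)%N -> apart p z ->
  K p z z p = 0.
Proof.
move=> ltp ltz spz; have := K_ricci p p.
rewrite (eq_bigr (fun w : 'I_27 => (apart p w)%:R * K p z z p)) => [|w _].
  rewrite -mulr_suml (sum_points (fun w => apart p w)).
  suff -> : sumn [seq (apart p w : nat) | w <- points] = 16%N.
    by move/eqP; rewrite mulf_eq0 pnatr_eq0 => /eqP.
  by apply/eqP; move: p ltp {spz}; apply: all27P; vm_compute.
have [spw|] := boolP (apart p w); first by rewrite mul1r -(curv_return ltp ltz).
rewrite /apart negb_and !negbK mul0r => /orP[ipw|/eqP <-].
  by rewrite (entry_inc (K_inv p w)) // inc_sym.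
exact: curv_diag0.
Qed.

Lemma curv_contracted_zero p z y : (p < 27)%N -> (z < 27)%N -> (y < 27)%N ->
  K p z z y = 0.
Proof.
move=> ltp ltz lty; have [->|pz] := eqVneq p z; first exact: curv_diag0.
have [izy|nizy] := boolP (inc z y); first by rewrite (entry_inc (K_inv p z)).
have [<-|zy] := eqVneq z y.
  have [ipz|nipz] := boolP (inc p z); first exact: curv_inc_zero.
  by apply: curv_apart_zero; rewrite // /apart nipz.
have szy : apart z y by rewrite /apart nizy.
have [py|py] := eqVneq p y.
  by rewrite -py in szy *; apply: curv_return_zero; rewrite // apart_sym.
have [ipy|nipy] := boolP (inc p y).
  have [ipz|nipz] := boolP (inc p z).
    by rewrite curv_inc_row // 1?apart_sym // curv_inc_zero ?mul0r.
  have szp : apart z p by rewrite apart_sym /apart nipz.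
  have /eqP := curv_inc_apart ltz ipy szp szy.
  have itz : inc (third p y) z by rewrite inc_third_apart // apart_sym.
  rewrite !curv_inc_zero // ?inc_third_r // !mulr0 addr0 mul0r.
  by rewrite mulf_eq0 signr_eq0 => /eqP.
have spy : apart p y by rewrite /apart nipy.
by rewrite curv_apart_row 1?eq_sym // curv_apart_zero.
Qed.

(** * From the summands of the Ricci trace to all entries *)

Definition near p q u := [|| u == p, u == q, inc p u | inc q u].

(** The diagonal of [K p q] is known to vanish at points near [p] or [q], so this triad gives it at
    [r]. *)
Lemma near_triad p q r : (p < 27)%N -> (q < 27)%N -> (r < 27)%N -> p != q ->
  exists u, [/\ inc r u, near p q u & near p q (third r u)].
Proof.
move=> ltp ltq ltr pq.
pose Q p q r := has (fun u => if near p q u then near p q (third r u) else false)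
  [seq u <- points | inc r u].
suff /hasP[u] : Q p q r.
  rewrite mem_filter => /andP[iru _]; case: ifP => // nu nv.
  by exists u.
move: r ltr; apply: (all27P (P := Q p q)).
apply: (all27_ifP (C := fun q => p != q) (P := fun q => all27 (Q p q)) _ ltq pq).
by move: p ltp {ltq pq}; apply: all27P; vm_compute.
Qed.

Lemma curv_diag_zero p q r : (p < 27)%N -> (q < 27)%N -> (r < 27)%N ->
  K p q r r = 0.
Proof.
move=> ltp ltq ltr.
have near0 u : near p q u -> (u < 27)%N -> K p q u u = 0.
  move=> nu ltu; case/or4P: nu => [/eqP->|/eqP->|ipu|iqu].
  - by rewrite K_anti curv_contracted_zero ?oppr0.
  - exact: curv_contracted_zero.
  - by rewrite curv_rows // curv_contracted_zero.
  - by rewrite K_anti curv_rows // curv_contracted_zero ?oppr0.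
have [->|pq] := eqVneq p q; first exact: curv_diag0.
have [u [iru nu nv]] := near_triad ltp ltq ltr pq.
have [ltu ltv] := (inc_ltr iru, inc_ltr (inc_third iru)).
by have := diag_triad (K_inv p q) iru; rewrite (near0 u) // (near0 (third r u)) // !addr0.
Qed.

(* The entries covered by [curv_contracted_zero], [curv_two_rows] and
   [symmetric_rows_off_diag], up to exchanging [p] and [q]. *)
Definition known_zero p q r s :=
  let sub_quadric p q := if ~~ inc p q then false else if ~~ inc p s then false
    else if r == q then false else s != third p q in
  if r == p then true else if r == q then true
  else if inc p r then if inc q r then true else sub_quadric p q
  else if inc q r then sub_quadric q p else false.

Lemma curv_known_zero p q r s : (p < 27)%N -> (q < 27)%N -> (s < 27)%N ->
  apart r s -> known_zero p q r s -> K p q r s = 0.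
Proof.
have quadric a b : inc a r -> apart r s ->
    (if ~~ inc a b then false else if ~~ inc a s then false
     else if r == b then false else s != third a b) -> K a b r s = 0.
  move=> iar /andP[_ rs]; case: ifP => // /negbFE iab; case: ifP => // /negbFE ias.
  case: ifP => // /negbT rb sb.
  apply: (symmetric_rows_off_diag (p := a) (K_inv a)) => // *.
  exact: curv_rows.
move=> ltp ltq lts srs; rewrite /known_zero /=.
have [->|rp] := eqVneq r p.
  by rewrite K_anti curv_contracted_zero ?oppr0.
have [->|rq] := eqVneq r q; first by rewrite curv_contracted_zero.
have [ipr|nipr] := boolP (inc p r).
  have [iqr _|niqr] := boolP (inc q r); first exact: curv_two_rows.
  by move=> H; apply: quadric => //; rewrite (negPf rq).
have [iqr|//] := boolP (inc q r).
by move=> H; rewrite K_anti quadric ?oppr0 ?(negPf rp).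
Qed.

(** The list consists of the six entries of one root: [rs] and its crossings over the common
    neighbours. *)
Definition crossed_known_zero p q rs :=
  has (fun ab => known_zero p q ab.1 ab.2)
    (rs :: [seq (third m rs.2, third m rs.1) | m <- points & inc m rs.1 && inc m rs.2]).

Lemma crossed_known_zeroP p q r s : (p < 27)%N -> (q < 27)%N -> (r < 27)%N ->
  (s < 27)%N -> (p < q)%N -> apart r s -> crossed_known_zero p q (r, s).
Proof.
move=> ltp ltq ltr lts pq srs.
(* Binding the list outside the loops over [p] and [q] lets it be evaluated once for each root
   entry. *)
pose Q r s := let ab := (r, s) :: [seq (third m s, third m r)
  | m <- points & inc m r && inc m s] in
  all27 (fun p => all27 (fun q => if (p < q)%N then
    has (fun ab => known_zero p q ab.1 ab.2) ab else true)).
have /all27P/(_ p ltp)/all27_ifP/(_ q ltq pq) : Q r s.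
  by move: r s ltr lts srs; apply: all_apartP; vm_compute.
by case/hasP=> ab abP kz; apply/hasP; exists ab.
Qed.

Theorem ricci_flat_zero p q r s :
  (p < 27)%N -> (q < 27)%N -> (r < 27)%N -> (s < 27)%N -> K p q r s = 0.
Proof.
wlog ltpq : p q / (p < q)%N.
  move=> hw ltp ltq ltr lts; case: (ltngtP p q) => [?|?|->].
  - exact: hw.
  - by rewrite K_anti hw ?oppr0.
  - exact: curv_diag0.
move=> ltp ltq ltr lts.
have [irs|nirs] := boolP (inc r s); first by rewrite (entry_inc (K_inv p q)).
have [->|rs] := eqVneq r s; first exact: curv_diag_zero.
have srs : apart r s by rewrite /apart nirs rs.
have := crossed_known_zeroP ltp ltq ltr lts ltpq srs.
case/orP=> [kz|/hasP[_ /mapP[m + ->] kz]]; first exact: curv_known_zero kz.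
rewrite mem_filter => /andP[/andP[imr ims] _].
have ltm := inc_ltr (inc_third imr).
rewrite (entry_cross (K_inv p q) imr ims) // (curv_known_zero _ _ _ _ kz) //.
  by rewrite mulr0 oppr0.
rewrite apart_third ?inc_third //.
by rewrite apart_sym apart_third // apart_sym.
Qed.

End RicciFlat.

(** * The invariant cubic form *)

Section CubicForm.
Variable F : numFieldType.
Local Notation V := 'cV[F]_27.
Local Notation basis p := (delta_mx p 0 : V).
Local Notation sgn := (sgn F).

Definition coef p q r : F := if inc p q && (third p q == r) then sgn p q else 0.

Lemma coef_swap p q r : coef p q r = coef q p r.
Proof.
rewrite /coef inc_sym; case: (boolP (inc q p)) => //= iqp.
by rewrite third_sym // sgn_sym.
Qed.

Lemma coef_rot p q r : coef p q r = coef q r p.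
Proof.
rewrite /coef; case: (boolP (inc p q)) => /= [ipq|nipq].
  have [<-|pqr] := eqVneq (third p q) r.
    have iqp : inc q p by rewrite inc_sym.
    by rewrite inc_third_r // -(third_sym ipq) thirdK // eqxx sgn_third // sgn_sym.
  case: ifP => // /andP[iqr /eqP qrp]; case/eqP: pqr.
  by rewrite -qrp third_sym ?inc_third // thirdK.
case: ifP => // /andP[iqr /eqP qrp]; case/negP: nipq.
by rewrite -qrp inc_sym inc_third.
Qed.

(** The polarization of the cubic: on the diagonal it is six times the signed sum of the triad
    monomials. *)
Definition cubic (x y z : V) : F :=
  \sum_(p < 27) \sum_(q < 27) \sum_(r < 27)
    coef p q r * (x p 0 * y q 0 * z r 0).

Lemma cubic_swap x y z : cubic x y z = cubic y x z.
Proof.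
rewrite /cubic exchange_big /=; apply: eq_bigr => p _.
apply: eq_bigr => q _; apply: eq_bigr => r _.
by rewrite coef_swap [x _ _ * _]mulrC.
Qed.

Lemma cubic_rot x y z : cubic x y z = cubic y z x.
Proof.
rewrite /cubic exchange_big /=; apply: eq_bigr => p _.
rewrite exchange_big /=; apply: eq_bigr => q _; apply: eq_bigr => r _.
by rewrite coef_rot; congr (_ * _); ring.
Qed.

Lemma cubic_linear y z : scalar (fun x => cubic x y z).
Proof.
move=> a x x'; rewrite /cubic mulr_sumr -big_split; apply: eq_bigr => p _ /=.
rewrite mulr_sumr -big_split; apply: eq_bigr => q _ /=.
rewrite mulr_sumr -big_split; apply: eq_bigr => r _ /=.
by rewrite !mxE; ring.
Qed.

Lemma cubicD x x' y z : cubic (x + x') y z = cubic x y z + cubic x' y z.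
Proof. by have := cubic_linear y z 1 x x'; rewrite scale1r mul1r. Qed.

Lemma cubicZ a x y z : cubic (a *: x) y z = a * cubic x y z.
Proof.
have := cubic_linear y z a x 0; rewrite addr0 => ->.
have := cubic_linear y z (-1) 0 0.
by rewrite scaler0 addr0 mulN1r addNr => ->; rewrite addr0.
Qed.

Lemma cubicB x x' y z : cubic (x - x') y z = cubic x y z - cubic x' y z.
Proof. by rewrite cubicD -scaleN1r cubicZ mulN1r. Qed.

Lemma cubicB2 x y y' z : cubic x (y - y') z = cubic x y z - cubic x y' z.
Proof. by rewrite ![cubic x _ z]cubic_swap cubicB. Qed.

Lemma cubicB3 x y z z' : cubic x y (z - z') = cubic x y z - cubic x y z'.
Proof. by rewrite ![cubic x y _]cubic_rot ![cubic y _ x]cubic_rot cubicB. Qed.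

Lemma cubic_delta x p q : cubic x (basis p) (basis q) =
  if inc p q then sgn p q * x (inord (third p q)) 0 else 0.
Proof.
rewrite cubic_rot /cubic (bigD1 p) //= [X in _ + X]big1 ?addr0; last first.
  move=> r rp; apply: big1 => r' _; apply: big1 => r'' _.
  by rewrite !mxE (negPf rp) /= !mul0r mulr0.
rewrite (bigD1 q) //= [X in _ + X]big1 ?addr0; last first.
  move=> r rq; apply: big1 => r' _.
  by rewrite !mxE (negPf rq) /= mulr0 !mul0r mulr0.
have [ipq|nipq] := boolP (inc p q); last first.
  by apply: big1 => r _; rewrite /coef (negPf nipq) mul0r.
have ltr := inc_ltr (inc_third ipq).
rewrite (bigD1 (inord (third p q))) //= big1 ?addr0; last first.
  move=> r; rewrite /coef ipq -val_eqE /= inordK // eq_sym => /negPf ->.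
  by rewrite mul0r.
by rewrite /coef ipq inordK // eqxx /= !mxE !eqxx /= !mul1r.
Qed.

Definition cubic_der (A : 'M[F]_27) x y z :=
  cubic (A *m x) y z + cubic x (A *m y) z + cubic x y (A *m z).

Definition preserves_cubic (l : F) (A : 'M[F]_27) :=
  forall x y z, cubic_der A x y z = l * cubic x y z.

(** Terms where [A] and [B] act on different arguments are symmetric in [A] and [B] and cancel. *)
Lemma preserves_cubic_bracket A B : preserves_cubic 0 A ->
  preserves_cubic 0 B -> preserves_cubic 0 (A *m B - B *m A).
Proof.
move=> A0 B0 x y z; rewrite mul0r /cubic_der !mulmxBl -!mulmxA.
rewrite cubicB cubicB2 cubicB3.
transitivity (cubic_der A (B *m x) y z + cubic_der A x (B *m y) z
    + cubic_der A x y (B *m z) - (cubic_der B (A *m x) y z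
    + cubic_der B x (A *m y) z + cubic_der B x y (A *m z))).
  by rewrite /cubic_der; ring.
by rewrite !A0 !B0 !mul0r; ring.
Qed.

Definition entry (A : 'M[F]_27) (r s : nat) : F := A (inord r) (inord s).

Lemma mulmx_delta (A : 'M[F]_27) (p q : 'I_27) : (A *m basis p) q 0 = A q p.
Proof. by rewrite -colE mxE. Qed.

Definition cubic_term (A : nat -> nat -> F) p q r :=
  if inc q r then sgn q r * A (third q r) p else 0.

Lemma cubic_der_delta A (p q r : 'I_27) :
  cubic_der A (basis p) (basis q) (basis r) =
  cubic_term (entry A) p q r + cubic_term (entry A) q r p
  + cubic_term (entry A) r p q.
Proof.
rewrite /cubic_der [cubic _ (A *m _) _]cubic_rot -[cubic _ _ (A *m _)]cubic_rot.
by rewrite !cubic_delta !mulmx_delta /cubic_term /entry !inord_val.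
Qed.

(** The three conditions are invariance on the basis triples [(s, s, third s r)],
    [(s, m, third m r)] and [(p, q, third p q)]. *)
Lemma preserves_cubic_triad_invariant l A : preserves_cubic l A ->
  triad_invariant l (entry A).
Proof.
move=> A_cub; have eqA p q r : (p < 27)%N -> (q < 27)%N -> (r < 27)%N ->
    cubic_term (entry A) p q r + cubic_term (entry A) q r p
    + cubic_term (entry A) r p q = l * coef p q r.
  move=> ltp ltq ltr.
  have := A_cub (basis (Ordinal ltp)) (basis (Ordinal ltq)) (basis (Ordinal ltr)).
  rewrite cubic_der_delta => ->.
  rewrite cubic_delta; congr (_ * _); rewrite coef_rot /coef /= mxE eqxx andbT.
  case: (boolP (inc q r)) => //= iqr.
  rewrite -val_eqE /= inordK; last exact: inc_ltr (inc_third iqr).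
  by case: eqP => _; rewrite (mulr1, mulr0).
split.
- move=> r s irs; have lts := inc_ltr irs.
  have isr : inc s r by rewrite inc_sym.
  have isc := inc_third isr; have ics : inc (third s r) s by rewrite inc_sym.
  have := eqA s s _ lts lts (inc_ltr isc).
  rewrite /cubic_term /coef incxx isc ics /= (third_sym isc) (thirdK isr).
  rewrite (sgn_sym _ isc) mulr0 addr0 => /two_eq0/eqP.
  by rewrite mulf_eq0 signr_eq0 => /eqP.
- move=> m r s imr ims srs; have imc := inc_third imr.
  have scs : apart (third m r) s by apply: apart_third.
  have := eqA s m _ (inc_ltr ims) (inc_ltl imr) (inc_ltr imc).
  have /negPf nics : ~~ inc (third m r) s by case/andP: scs.
  rewrite /cubic_term /coef imc nics [inc s m]inc_sym ims /= thirdK //.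
  have -> : (third s m == third m r) = false.
    apply/eqP => e; move: nics; rewrite -e inc_sym inc_third //.
    by rewrite inc_sym.
  rewrite mulr0 addr0 sgn_third // (sgn_sym _ ims) (third_sym ims) => /eqP.
  rewrite addr_eq0 => /eqP e.
  by rewrite -[LHS]mul1r -(sgnK F m r) -mulrA e; ring.
- move=> p q ipq; have ipt := inc_third ipq; have iqt := inc_third_r ipq.
  have itp : inc (third p q) p by rewrite inc_sym.
  have := eqA p q _ (inc_ltl ipq) (inc_ltr ipq) (inc_ltr ipt).
  rewrite /cubic_term /coef ipq iqt itp eqxx /=.
  have -> : third q (third p q) = p.
    by rewrite -(third_sym ipq) thirdK // inc_sym.
  have -> : third (third p q) p = q by rewrite third_sym // thirdK.
  have -> : sgn q (third p q) = sgn p q.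
    by rewrite -(third_sym ipq) sgn_third 1?inc_sym // sgn_sym.
  have -> : sgn (third p q) p = sgn p q by rewrite sgn_sym // sgn_third.
  rewrite [l * _]mulrC -!mulrDr => /mulfI; apply; exact/negbT/signr_eq0.
Qed.

End CubicForm.

(** * Combinatorics of the weights and of the simple roots *)

Section Weights.

Definition cart (i j : nat) : int :=
  if i == j then 2%:Z else if e6_edge i j || e6_edge j i then - 1%:Z else 0.

(* The pair [(p, i)] in position [q - 1] says that the weight of [q] is that
   of [p] minus the simple root [i]. *)
Definition descents : seq (nat * nat) :=
  [:: (0, 0); (1, 2); (2, 3); (3, 1); (3, 4); (4, 4); (5, 5); (6, 3); (6, 5);
      (8, 2); (8, 5); (10, 0); (10, 5); (11, 4); (12, 5); (13, 4); (15, 4);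
      (16, 3); (17, 3); (18, 1); (19, 1); (19, 2); (21, 2); (23, 3); (24, 4);
      (25, 5)]%N.

Definition words : seq (seq nat) := Eval vm_compute in
  foldl (fun ws d => rcons ws (d.2 :: nth [::] ws d.1)) [:: [::]] descents.

Definition word p := nth [::] words p.

Definition word_weight (w : seq nat) (i : nat) : int :=
  foldr (fun j a => a - cart i j) (i == 0%N)%:Z w.

Definition weight_table : seq (seq int) := Eval vm_compute in
  [seq [seq word_weight w i | i <- iota 0 6] | w <- words].

Definition weight p i : int := nth 0 (nth [::] weight_table p) i.

Definition has_weight (mu : nat -> int) p :=
  all (fun i => weight p i == mu i) (iota 0 6).

Definition lower_table : seq (seq nat) := Eval vm_compute in
  [seq [seq find (has_weight (fun j => weight p j - cart j i)) points
       | p <- points] | i <- iota 0 6].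

Definition upper_table : seq (seq nat) := Eval vm_compute in
  [seq [seq find (has_weight (fun j => weight p j + cart j i)) points
       | p <- points] | i <- iota 0 6].

(* The value 27 stands for "not a weight". *)
Definition lower i p := nth 27%N (nth [::] lower_table i) p.
Definition upper i p := nth 27%N (nth [::] upper_table i) p.

(** Each letter lowers a vector on which its coroot has value 1, as [sl2_lowering_neq0] requires.
    The head of a word acts last. *)
Fixpoint descending (w : seq nat) :=
  if w is j :: w' then [&& (j < 6)%N, word_weight w' j == 1 & descending w']
  else true.

Lemma word_descending p : (p < 27)%N -> descending (word p).
Proof. by move: p; apply: all27P; vm_compute. Qed.

Lemma all6_27P (P : nat -> nat -> bool) :
  all (fun i => all27 (fun p => P i p)) (iota 0 6) ->
  forall i p, (i < 6)%N -> (p < 27)%N -> P i p.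
Proof.
move=> /allP H i p lti; apply: (all27P (P := fun p => P i p)).
by apply: H; rewrite mem_iota.
Qed.

Lemma word_weightE p i : (p < 27)%N -> (i < 6)%N ->
  word_weight (word p) i = weight p i.
Proof.
move=> ltp lti; apply/eqP; move: i p lti ltp.
by apply: all6_27P; vm_compute.
Qed.

(* Balanced ternary separates the weights, whose coordinates are -1, 0, 1. *)
Definition weight_code p : int :=
  foldr (fun i a => weight p i + 3%:Z * a) 0 (iota 0 6).

Lemma weight_code_inj p q : (p < 27)%N -> (q < 27)%N ->
  weight_code p = weight_code q -> p = q.
Proof.
move=> ltp ltq /eqP pq; apply/eqP.
apply: (all27_ifP (C := fun q => weight_code p == weight_code q)) ltq pq.
by move: p ltp; apply: all27P; vm_compute.
Qed.

Lemma all6_27_ifP (C P : nat -> nat -> bool) :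
  all (fun i => all27 (fun p => if C i p then P i p else true)) (iota 0 6) ->
  forall i p, (i < 6)%N -> (p < 27)%N -> C i p -> P i p.
Proof.
by move=> CP i p lti ltp Cip; have := all6_27P CP lti ltp; rewrite /= Cip.
Qed.

Lemma lower_none i p : (i < 6)%N -> (p < 27)%N -> ~~ (lower i p < 27)%N ->
  all27 (fun q => ~~ has_weight (fun j => weight p j - cart j i) q).
Proof.
move: i p; apply: (all6_27_ifP (C := fun i p => ~~ (lower i p < 27)%N)
  (P := fun i p => all27 (fun q =>
    ~~ has_weight (fun j => weight p j - cart j i) q))).
by vm_compute.
Qed.

Lemma upper_none i p : (i < 6)%N -> (p < 27)%N -> ~~ (upper i p < 27)%N ->
  all27 (fun q => ~~ has_weight (fun j => weight p j + cart j i) q).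
Proof.
move: i p; apply: (all6_27_ifP (C := fun i p => ~~ (upper i p < 27)%N)
  (P := fun i p => all27 (fun q =>
    ~~ has_weight (fun j => weight p j + cart j i) q))).
by vm_compute.
Qed.

(** A commuting square: [p] is reached from [r] by [j], the nodes [i] and [j] are not joined, and
    the chosen word of [lower i p] takes the other way around, through [lower i r]. *)
Definition lower_square i p r :=
  let q := lower i p in let j := head 0%N (word q) in
  [&& (r < p)%N, lower j r == p, (lower i r < 27)%N,
      word q == j :: word (lower i r), cart i j == 0, i != j & (j < 6)%N].

Lemma lower_cases i p : (i < 6)%N -> (p < 27)%N -> (lower i p < 27)%N ->
  word (lower i p) = i :: word p \/ exists r, lower_square i p r.
Proof.
move=> lti ltp ltl; have : (word (lower i p) == i :: word p)
    || has (lower_square i p) points.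
  move: i p lti ltp ltl.
  apply: (all6_27_ifP (C := fun i p => (lower i p < 27)%N)
    (P := fun i p => (word (lower i p) == i :: word p)
      || has (lower_square i p) points)).
  by vm_compute.
by case/orP => [/eqP|/hasP[r _ sq]]; [left | right; exists r].
Qed.

Lemma upper_some i p : (i < 6)%N -> (p < 27)%N -> (upper i p < 27)%N ->
  [&& lower i (upper i p) == p, weight (upper i p) i == 1
    & ~~ (upper i (upper i p) < 27)%N].
Proof.
move: i p; apply: (all6_27_ifP (C := fun i p => (upper i p < 27)%N)
  (P := fun i p => [&& lower i (upper i p) == p, weight (upper i p) i == 1
    & ~~ (upper i (upper i p) < 27)%N])).
by vm_compute.
Qed.

End Weights.

(** * Linear algebra of weight vectors: lowering in sl2 and independence *)

Section Sl2.
Variables (F : numFieldType) (n : nat) (E D H : 'M[F]_n).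
Hypothesis HE : H *m E - E *m H = 2%:R *: E.
Hypothesis ED : E *m D - D *m E = H.

(** If [D] killed [x], the vectors [E^k x] would all be nonzero, since [D] sends [E^(k+1) x] to
    [-(k+1)^2 E^k x], and would have the distinct eigenvalues [1 + 2k]. *)
Lemma sl2_lowering_neq0 (x : 'cV[F]_n) : x != 0 -> H *m x = x -> D *m x != 0.
Proof.
move=> x0 Hx; apply/negP => /eqP Dx.
pose y k := iter k (mulmx E) x.
have Hy k : H *m y k = (1 + 2 * k)%:R *: y k.
  elim: k => [|k IH]; first by rewrite muln0 addn0 scale1r.
  have HEy : H *m E = E *m H + 2%:R *: E by rewrite -HE addrC subrK.
  rewrite /= mulmxA HEy mulmxDl -mulmxA IH -scalemxAl -scalemxAr -scalerDl.
  by rewrite -natrD mulnS addnCA [in RHS]addnC addnA.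
have Dy k : D *m y k.+1 = - (k.+1 ^ 2)%:R *: y k.
  elim: k => [|k IH].
    have -> : D *m y 1 = E *m (D *m x) - H *m x.
      by rewrite -ED mulmxBl !mulmxA opprB addrC subrK.
    by rewrite Dx mulmx0 Hx sub0r scaleN1r.
  have -> : D *m y k.+2 = E *m (D *m y k.+1) - H *m y k.+1.
    by rewrite -ED mulmxBl !mulmxA opprB addrC subrK.
  rewrite IH Hy -scalemxAr -[E *m y k]/(y k.+1) -scaleNr -scalerDl.
  congr (_ *: _); rewrite -opprD -natrD; congr (- _%:R).
  by rewrite -mulnn; ring.
have y0 k : y k != 0.
  elim: k => // k IH; apply/negP => /eqP yk.
  have := Dy k; rewrite yk mulmx0 => /eqP; rewrite eq_sym.
  by rewrite ?oppr_eq0 scaler_eq0 ?oppr_eq0 pnatr_eq0 (negPf IH).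
pose rs := mkseq (fun k => (1 + 2 * k)%:R : F) n.+1.
(* These [n + 1] roots are one more than the degree; the transpose appears because [eigenvalue] is
   about row vectors. *)
have := @max_poly_roots _ (char_poly H^T) rs.
rewrite size_char_poly size_mkseq ltnn => contra.
apply/idP: isT; apply: contra => //.
- by rewrite -size_poly_eq0 size_char_poly.
- apply/allP => _ /mapP[k _ ->]; rewrite -eigenvalue_root_char.
  apply/eigenvalueP; exists (y k)^T; last by rewrite trmx_eq0.
  by rewrite -trmx_mul Hy linearZ.
- apply/mkseq_uniqP => i j _ _ /eqP; rewrite eqr_nat eqn_add2l.
  by rewrite eqn_pmul2l // => /eqP.
Qed.

End Sl2.

(** Applied to a relation between the columns, the product of the [H - a q] over [q != p] leaves
    only column [p]. *)
Lemma eigenvectors_unit (F : fieldType) n (H P : 'M[F]_n) (a : 'I_n -> F) :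
  injective a -> (forall p, col p P != 0) ->
  (forall p, H *m col p P = a p *: col p P) -> P \in unitmx.
Proof.
move=> a_inj P0 HP; rewrite -unitmx_tr -row_free_unit.
apply: inj_row_free => x /(congr1 trmx); rewrite trmx_mul trmxK trmx0 => Px.
pose op rs (y : 'cV[F]_n) := foldr (fun b y => H *m y - b *: y) y rs.
have opP rs y : op rs (P *m y)
    = \sum_p (y p 0 * \prod_(b <- rs) (a p - b)) *: col p P.
  elim: rs => [|b rs IH] /=.
    apply/matrixP => i j; rewrite mxE summxE; apply: eq_bigr => p _.
    by rewrite !mxE big_nil mulr1 ord1 mulrC.
  rewrite IH mulmx_sumr scaler_sumr -sumrB; apply: eq_bigr => p _.
  by rewrite -scalemxAr HP !scalerA -scalerBl big_cons; congr (_ *: _); ring.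
have op0 rs : op rs 0 = 0.
  by elim: rs => //= b rs ->; rewrite mulmx0 scaler0 subr0.
apply/rowP => p; rewrite mxE.
have := opP [seq a q | q <- enum 'I_n & q != p] x^T.
rewrite Px op0 (bigD1 p) //= [X in _ + X]big1 ?addr0 => [|q qp].
  move/esym/eqP; rewrite scaler_eq0 (negPf (P0 p)) orbF mulf_eq0 mxE.
  case/orP => [/eqP //|]; rewrite prodf_seq_eq0 => /hasP[_ /mapP[q + ->]].
  by rewrite mem_filter subr_eq0 => /andP[/negP qp _] /eqP/a_inj/esym/eqP.
rewrite (_ : \prod_(_ <- _) _ = 0) ?mulr0 ?scale0r //.
apply/eqP; rewrite prodf_seq_eq0; apply/hasP; exists (a q).
  by apply: map_f; rewrite mem_filter qp mem_enum.
by rewrite subrr eqxx.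
Qed.

(** * A basis of weight vectors and the action of the generators on it *)

Section WeightBasis.
Variables (F : numFieldType) (E D H : nat -> 'M[F]_27) (v : 'cV[F]_27).
Hypothesis HE : forall i j, (i < 6)%N -> (j < 6)%N ->
  H i *m E j - E j *m H i = (cart i j)%:~R *: E j.
Hypothesis HD : forall i j, (i < 6)%N -> (j < 6)%N ->
  H i *m D j - D j *m H i = - (cart i j)%:~R *: D j.
Hypothesis ED : forall i j, (i < 6)%N -> (j < 6)%N ->
  E i *m D j - D j *m E i = if i == j then H i else 0.
Hypothesis DD : forall i j, (i < 6)%N -> (j < 6)%N -> i != j ->
  cart i j = 0 -> D i *m D j = D j *m D i.
Hypothesis v0 : v != 0.
Hypothesis Hv : forall i, (i < 6)%N -> H i *m v = (i == 0%N)%:R *: v.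

Definition word_vec w := foldr (fun j x => D j *m x) v w.
Definition weight_vec p := word_vec (word p).

Lemma raise_weight i j (x : 'cV[F]_27) (a : int) : (i < 6)%N -> (j < 6)%N ->
  H i *m x = a%:~R *: x ->
  H i *m (E j *m x) = (a + cart i j)%:~R *: (E j *m x).
Proof.
move=> lti ltj Hx; have /eqP := HE lti ltj; rewrite subr_eq => /eqP HEx.
rewrite mulmxA HEx mulmxDl -mulmxA Hx -scalemxAl -scalemxAr -scalerDl.
by rewrite intrD addrC.
Qed.

Lemma lower_weight i j (x : 'cV[F]_27) (a : int) : (i < 6)%N -> (j < 6)%N ->
  H i *m x = a%:~R *: x ->
  H i *m (D j *m x) = (a - cart i j)%:~R *: (D j *m x).
Proof.
move=> lti ltj Hx; have /eqP := HD lti ltj; rewrite subr_eq => /eqP HDx.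
rewrite mulmxA HDx mulmxDl -mulmxA Hx -scalemxAl -scalemxAr -scalerDl.
by rewrite intrB addrC.
Qed.

Lemma word_vec_weight w i : (i < 6)%N -> descending w ->
  H i *m word_vec w = (word_weight w i)%:~R *: word_vec w.
Proof.
move=> lti; elim: w => [_|j w IH /and3P[ltj _ dw]] /=.
  by rewrite Hv //; case: eqP.
by apply: lower_weight => //; apply: IH.
Qed.

Lemma word_vec_neq0 w : descending w -> word_vec w != 0.
Proof.
elim: w => [//|j w IH] /and3P[ltj /eqP wj dw] /=.
apply: (@sl2_lowering_neq0 _ _ (E j) (D j) (H j)).
- by rewrite HE // /cart eqxx.
- by rewrite ED // eqxx.
- exact: IH.
- by rewrite word_vec_weight // wj scale1r.
Qed.

Lemma weight_vec_neq0 p : (p < 27)%N -> weight_vec p != 0.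
Proof. by move=> ltp; apply/word_vec_neq0/word_descending. Qed.

Lemma weight_vecP p i : (p < 27)%N -> (i < 6)%N ->
  H i *m weight_vec p = (weight p i)%:~R *: weight_vec p.
Proof.
move=> ltp lti; rewrite word_vec_weight ?word_descending //.
by rewrite word_weightE.
Qed.

Definition weight_basis : 'M[F]_27 := \matrix_(r, p) weight_vec p r 0.

Lemma col_weight_basis (p : 'I_27) : col p weight_basis = weight_vec p.
Proof. by apply/colP => r; rewrite !mxE. Qed.

Lemma weight_basis_unit : weight_basis \in unitmx.
Proof.
(* This operator has on [weight_vec p] the eigenvalue [weight_code p], and these codes are
   distinct. *)
pose Hsum : 'M[F]_27 := foldr (fun i A => H i + 3%:R *: A) 0 (iota 0 6).
apply: (eigenvectors_unit (H := Hsum)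
          (a := fun p : 'I_27 => (weight_code p)%:~R)).
- by move=> p q /intr_inj/weight_code_inj pq; apply/val_inj/pq.
- by move=> p; rewrite col_weight_basis weight_vec_neq0.
- move=> p; rewrite col_weight_basis /Hsum /weight_code.
  have : all (fun i => i < 6)%N (iota 0 6) by [].
  elim: (iota 0 6) => [_|i s IH /andP[lti lts]] /=.
    by rewrite mul0mx scale0r.
  rewrite mulmxDl -scalemxAl IH // weight_vecP // scalerA -scalerDl.
  by rewrite rmorphD rmorphM.
Qed.

Lemma weight_space (x : 'cV[F]_27) (mu : nat -> int) :
    (forall i, (i < 6)%N -> H i *m x = (mu i)%:~R *: x) ->
  exists2 y : 'I_27 -> F, x = \sum_p y p *: weight_vec p &
    forall p : 'I_27, ~~ has_weight mu p -> y p = 0.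
Proof.
move=> Hx; pose y := invmx weight_basis *m x.
have xE : x = \sum_p y p 0 *: weight_vec p.
  rewrite -[LHS](mulKVmx weight_basis_unit) -/y.
  apply/colP => i; rewrite mxE summxE; apply: eq_bigr => p _.
  by rewrite !mxE mulrC.
exists (fun p => y p 0) => // p; rewrite /has_weight.
case/allPn=> i; rewrite mem_iota => /= lti wpi.
have: weight_basis *m (\col_q (((weight q i)%:~R - (mu i)%:~R) * y q 0)) = 0.
  have -> : weight_basis *m (\col_q (((weight q i)%:~R - (mu i)%:~R) * y q 0))
      = H i *m x - (mu i)%:~R *: x.
    rewrite xE mulmx_sumr scaler_sumr -sumrB.
    apply/colP => r; rewrite mxE summxE; apply: eq_bigr => q _.
    rewrite -scalemxAr weight_vecP // !scalerA -scalerBl.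
    by rewrite !mxE; ring.
  by rewrite Hx // subrr.
move/(congr1 (mulmx (invmx weight_basis))).
rewrite mulKmx ?weight_basis_unit // mulmx0 => /colP/(_ p).
rewrite !mxE => /eqP; rewrite mulf_eq0 -rmorphB /= intr_eq0 subr_eq0.
by rewrite (negPf wpi) => /eqP.
Qed.

Lemma weight_absent (x : 'cV[F]_27) (mu : nat -> int) :
    (forall i, (i < 6)%N -> H i *m x = (mu i)%:~R *: x) ->
    all27 (fun p => ~~ has_weight mu p) -> x = 0.
Proof.
move=> /weight_space[y -> y0] /all27P no_mu; apply: big1 => p _.
by rewrite y0 ?scale0r // no_mu.
Qed.

Lemma lower_vec0 i p : (i < 6)%N -> (p < 27)%N -> ~~ (lower i p < 27)%N ->
  D i *m weight_vec p = 0.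
Proof.
move=> lti ltp nl; apply: weight_absent (lower_none lti ltp nl) => j ltj.
by apply: lower_weight => //; apply: weight_vecP.
Qed.

Lemma raise_vec0 i p : (i < 6)%N -> (p < 27)%N -> ~~ (upper i p < 27)%N ->
  E i *m weight_vec p = 0.
Proof.
move=> lti ltp nu; apply: weight_absent (upper_none lti ltp nu) => j ltj.
by apply: raise_weight => //; apply: weight_vecP.
Qed.

(** Either the word of [lower i p] starts with [i], or a commuting square reduces to a smaller point
    [r]. *)
Lemma lower_vec i p : (i < 6)%N -> (p < 27)%N -> (lower i p < 27)%N ->
  D i *m weight_vec p = weight_vec (lower i p).
Proof.
move: i; have [n] := ubnP p; elim: n p => // n IH p le_pn i lti ltp ltl.
have [wE|[r]] := lower_cases lti ltp ltl; first by rewrite /weight_vec wE.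
rewrite /lower_square; set j := head _ _.
case/and5P=> ltrp /eqP jr ltir /eqP wE /and3P[/eqP cij ij ltj].
have ltr : (r < 27)%N by apply: ltn_trans ltrp ltp.
have ltrn : (r < n)%N by apply: leq_trans ltrp _; rewrite -ltnS.
have Djr : D j *m weight_vec r = weight_vec p by rewrite IH ?jr.
rewrite -Djr mulmxA DD // -mulmxA IH //.
by rewrite /weight_vec wE.
Qed.

(** Writing the vector as [D i] of the one above, [E D = H + D E], where [H] acts by 1 and [E] kills
    the top of the root string. *)
Lemma raise_vec i p : (i < 6)%N -> (p < 27)%N -> (upper i p < 27)%N ->
  E i *m weight_vec p = weight_vec (upper i p).
Proof.
move=> lti ltp ltu.
have /and3P[/eqP lu /eqP wu nuu] := upper_some lti ltp ltu.
rewrite -{1}lu -lower_vec ?lu // mulmxA.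
have /eqP := ED lti lti; rewrite eqxx subr_eq => /eqP ->.
by rewrite mulmxDl -mulmxA raise_vec0 // mulmx0 addr0 weight_vecP // wu scale1r.
Qed.

Lemma weight_basis_conj (A : 'M[F]_27) (a : nat -> nat -> int) :
    (forall s : 'I_27, A *m weight_vec s
       = \sum_(r < 27) (a r s)%:~R *: weight_vec r) ->
  invmx weight_basis *m A *m weight_basis = \matrix_(r, s) (a r s)%:~R.
Proof.
move=> Aa; rewrite -mulmxA.
apply: (canLR (mulKmx weight_basis_unit)); apply/matrixP => i s.
have -> : (A *m weight_basis) i s = (A *m weight_vec s) i 0.
  by rewrite -col_weight_basis colE mulmxA -colE [RHS]mxE.
rewrite Aa summxE mxE.
by apply: eq_bigr => r _; rewrite !mxE mulrC.
Qed.

Lemma sum_pick (q : nat) : \sum_(r < 27) ((q == r : nat)%:Z)%:~R *: weight_vec r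
  = if (q < 27)%N then weight_vec q else 0.
Proof.
case: ifP => [ltq|/negbT geq].
  rewrite (bigD1 (Ordinal ltq)) //= eqxx scale1r big1 ?addr0 // => r.
  by rewrite -val_eqE /= eq_sym => /negPf ->; rewrite scale0r.
apply: big1 => r _; case: eqP => [qr|_]; last by rewrite scale0r.
by rewrite qr ltn_ord in geq.
Qed.

End WeightBasis.

(** * Invariance of the cubic form under the generators, by integer computation *)

Section CubicCheck.
Variable F : numFieldType.
Local Notation V := 'cV[F]_27.
Local Notation basis p := (delta_mx p 0 : V).

Lemma cubic_der_rot (A : 'M[F]_27) x y z :
  cubic_der A x y z = cubic_der A y z x.
Proof.
by rewrite /cubic_der ![cubic _ y z]cubic_rot [cubic x _ z]cubic_rot
  [cubic x y _]cubic_rot; ring.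
Qed.

Lemma cubic_der_linear (A : 'M[F]_27) y z : scalar (fun x => cubic_der A x y z).
Proof.
move=> a x x'; rewrite /cubic_der mulmxDr -scalemxAr.
by rewrite !cubicD !cubicZ; ring.
Qed.

Lemma scalar_eq0 n (f : 'cV[F]_n -> F) : scalar f ->
  (forall p, f (delta_mx p 0) = 0) -> forall x, f x = 0.
Proof.
move=> lin_f f0 x.
have fD : {morph f : x y / x + y} by move=> y z; have := lin_f 1 y z;
  rewrite scale1r mul1r.
have f00 : f 0 = 0 by apply: (addrI (f 0)); rewrite -fD !addr0.
rewrite (matrix_sum_delta x) (big_morph f fD f00) big1 // => p _.
rewrite big_ord1; have := lin_f (x p 0) (delta_mx p 0) 0.
by rewrite addr0 f0 f00 mulr0 addr0.
Qed.

Lemma preserves_cubic_basis (A : 'M[F]_27) :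
    (forall p q r, cubic_der A (basis p) (basis q) (basis r) = 0) ->
  preserves_cubic 0 A.
Proof.
move=> A0 x y z; rewrite mul0r.
move: x; apply: scalar_eq0 => [|p]; first exact: cubic_der_linear.
rewrite cubic_der_rot; move: y; apply: scalar_eq0 => [|q].
  exact: cubic_der_linear.
rewrite cubic_der_rot; move: z; apply: scalar_eq0 => [|r].
  exact: cubic_der_linear.
by rewrite cubic_der_rot.
Qed.

Definition int_term (a : nat -> nat -> int) p q r : int :=
  if inc q r then
    if negative q r then - a (third q r) p else a (third q r) p
  else 0.

Definition int_cubic (a : nat -> nat -> int) :=
  all27 (fun p => all27_2 (fun q r =>
    int_term a p q r + int_term a q r p + int_term a r p q == 0)).

Lemma int_cubicP a : int_cubic a ->
  preserves_cubic 0 (\matrix_(r, s) (a r s)%:~R : 'M[F]_27).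
Proof.
move=> a_cub; apply: preserves_cubic_basis => p q r; rewrite cubic_der_delta.
set A := \matrix_(_, _) _.
have termE x y z : (x < 27)%N -> cubic_term (entry A) x y z
    = (int_term a x y z)%:~R.
  rewrite /cubic_term /int_term => ltx; case: ifP => // iyz.
  rewrite /entry mxE !inordK ?(inc_ltr (inc_third iyz)) // /sgn.
  by case: negative; rewrite ?rmorphN /= ?mulN1r ?mul1r.
rewrite !termE // -!rmorphD /=.
by rewrite (eqP (all27_2P (all27P a_cub _) _ _)).
Qed.

Lemma lower_cubic : all (fun i => int_cubic (fun r s => (lower i s == r : nat)%:Z))
  (iota 0 6).
Proof. by vm_compute. Qed.

Lemma upper_cubic : all (fun i => int_cubic (fun r s => (upper i s == r : nat)%:Z))
  (iota 0 6).
Proof. by vm_compute. Qed.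

Lemma weight_cubic : all (fun i => int_cubic (fun r s =>
  if s == r then weight s i else 0)) (iota 0 6).
Proof. by vm_compute. Qed.

End CubicCheck.

(** * Invariance of the cubic form under the whole algebra *)

Section Representation.
Variables (F : numFieldType) (L : vectType F) (br : L -> L -> L).
Variables (e f h : 'I_6 -> L) (rho : 'Hom(L, 'M[F]_27)).
Hypothesis br_e6 : is_e6_chevalley_system br e f h.
Hypothesis rho_rep : is_lie_rep br rho.
Variable v : 'cV[F]_27.
Hypothesis v0 : v != 0.
Hypothesis hv : forall i : 'I_6, rho (h i) *m v = (i == ord0)%:R *: v.

Let E i := rho (e (inord i)).
Let D i := rho (f (inord i)).
Let H i := rho (h (inord i)).

Lemma e6_cartan_inord i j : (i < 6)%N -> (j < 6)%N ->
  e6_cartan (inord i) (inord j) = cart i j.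
Proof.
by move=> lti ltj; rewrite /e6_cartan /cart -val_eqE /= !inordK.
Qed.

Let HE i j : (i < 6)%N -> (j < 6)%N ->
  H i *m E j - E j *m H i = (cart i j)%:~R *: E j.
Proof.
by move=> lti ltj; rewrite -rho_rep (e6_he br_e6) linearZ /= e6_cartan_inord.
Qed.

Let HD i j : (i < 6)%N -> (j < 6)%N ->
  H i *m D j - D j *m H i = - (cart i j)%:~R *: D j.
Proof.
by move=> lti ltj; rewrite -rho_rep (e6_hf br_e6) linearZ /= e6_cartan_inord.
Qed.

Let ED i j : (i < 6)%N -> (j < 6)%N ->
  E i *m D j - D j *m E i = if i == j then H i else 0.
Proof.
move=> lti ltj; rewrite -rho_rep (e6_ef br_e6) -val_eqE /= !inordK //.
by case: eqP => // _; rewrite linear0.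
Qed.

Let DD i j : (i < 6)%N -> (j < 6)%N -> i != j -> cart i j = 0 ->
  D i *m D j = D j *m D i.
Proof.
move=> lti ltj ij cij.
have := e6_serre_f br_e6 (i := inord i) (j := inord j).
rewrite e6_cartan_inord // cij -val_eqE /= !inordK // => /(_ ij) ff.
by apply/eqP; rewrite -subr_eq0 -rho_rep ff linear0.
Qed.

Let Hv i : (i < 6)%N -> H i *m v = (i == 0%N)%:R *: v.
Proof. by move=> lti; rewrite hv -val_eqE /= inordK. Qed.

Definition e6_basis : 'M[F]_27 := weight_basis D v.

Lemma e6_basis_unit : e6_basis \in unitmx.
Proof. exact: (weight_basis_unit HE HD ED v0 Hv). Qed.

Definition conj_e6 (A : 'M[F]_27) := invmx e6_basis *m A *m e6_basis.

Lemma conj_e6_linear : linear conj_e6.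
Proof.
by move=> a A B; rewrite /conj_e6 mulmxDr mulmxDl -scalemxAr -scalemxAl.
Qed.

Lemma conj_e6_bracket A B : conj_e6 (A *m B - B *m A) =
  conj_e6 A *m conj_e6 B - conj_e6 B *m conj_e6 A.
Proof.
rewrite /conj_e6 mulmxBr mulmxBl.
by rewrite -!mulmxA !(mulKVmx e6_basis_unit).
Qed.

Let generators_cubic i : (i < 6)%N -> [/\ preserves_cubic 0 (conj_e6 (E i)),
  preserves_cubic 0 (conj_e6 (D i)) & preserves_cubic 0 (conj_e6 (H i))].
Proof.
move=> lti; have i6 : i \in iota 0 6 by rewrite mem_iota.
split.
- rewrite /conj_e6 (weight_basis_conj HE HD ED v0 Hv
    (a := fun r s => (upper i s == r : nat)%:Z)) => [|s].
    exact: int_cubicP (allP upper_cubic i i6).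
  rewrite sum_pick; case: ifP => [ltu|/negbT nu].
    exact: (raise_vec HE HD ED DD v0 Hv).
  exact: (raise_vec0 HE HD ED v0 Hv).
- rewrite /conj_e6 (weight_basis_conj HE HD ED v0 Hv
    (a := fun r s => (lower i s == r : nat)%:Z)) => [|s].
    exact: int_cubicP (allP lower_cubic i i6).
  rewrite sum_pick; case: ifP => [ltl|/negbT nl].
    exact: (lower_vec v DD).
  exact: (lower_vec0 HE HD ED v0 Hv).
- rewrite /conj_e6 (weight_basis_conj HE HD ED v0 Hv
    (a := fun r s => if s == r then weight s i else 0)) => [|s].
    exact: int_cubicP (allP weight_cubic i i6).
  rewrite (weight_vecP HD Hv) // (bigD1 s) //= eqxx big1 ?addr0 // => r.
  by rewrite -val_eqE eq_sym => /negPf ->; rewrite scale0r.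
Qed.

Lemma cubic_der_matrix_linear (x y z : 'cV[F]_27) :
  scalar (fun A => cubic_der A x y z).
Proof.
move=> a A B; rewrite /cubic_der !mulmxDl -!scalemxAl.
rewrite cubicD cubicZ [cubic x (_ + _) _]cubic_swap cubicD cubicZ.
rewrite [cubic x y (_ + _)]cubic_rot [cubic y _ x]cubic_rot cubicD cubicZ.
rewrite ![cubic _ x z]cubic_swap ![cubic _ x y]cubic_rot.
by ring.
Qed.

(** The elements annihilating the form make up a subalgebra containing the Chevalley generators. *)
Lemma rho_cubic l : preserves_cubic 0 (conj_e6 (rho l)).
Proof.
(* Collecting the values on all basis triples exhibits this subalgebra as the kernel of a linear
   map, hence as a [{vspace L}]. *)
pose G l : {ffun 'I_27 * 'I_27 * 'I_27 -> F^o} := [ffun t => cubic_der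
  (conj_e6 (rho l)) (delta_mx t.1.1 0) (delta_mx t.1.2 0) (delta_mx t.2 0)].
have G_linear : linear G.
  move=> a x y; apply/ffunP => t; rewrite !ffunE linearP conj_e6_linear.
  exact: cubic_der_matrix_linear.
pose linG : {linear L -> {ffun 'I_27 * 'I_27 * 'I_27 -> F^o}} :=
  HB.pack G (GRing.isLinear.Build _ _ _ _ _ G_linear).
pose U := lker (linfun linG).
have mem_U x : (x \in U) <-> preserves_cubic 0 (conj_e6 (rho x)).
  rewrite memv_ker lfunE /=; split => [/eqP/ffunP Gx|xcub].
    apply: preserves_cubic_basis => p q r.
    by have := Gx (p, q, r); rewrite !ffunE.
  by apply/eqP/ffunP => t; rewrite !ffunE xcub mul0r.
apply/mem_U; rewrite (e6_generated br_e6 (U := U)) ?memvf //.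
  move=> x y /mem_U xcub /mem_U ycub; apply/mem_U.
  by rewrite rho_rep conj_e6_bracket; apply: preserves_cubic_bracket.
move=> i; have [e_cub f_cub h_cub] := generators_cubic (ltn_ord i).
by split; apply/mem_U; [move: e_cub | move: f_cub | move: h_cub];
  rewrite /E /D /H inord_val.
Qed.

Lemma scalars_plus_image_triad_invariant A : A \in scalars_plus_image rho ->
  exists l, triad_invariant l (entry (conj_e6 A)).
Proof.
case/memv_addP=> _ /vlineP[c ->] [_ /memv_imgP[l _ ->] ->].
(* The identity acts on a cubic form by the factor 3. *)
exists (3%:R * c); apply: preserves_cubic_triad_invariant => x y z.
rewrite conj_e6_linear cubic_der_matrix_linear rho_cubic mul0r addr0.
rewrite /conj_e6 mulmx1 mulVmx ?e6_basis_unit // /cubic_der !mul1mx.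
by ring.
Qed.

End Representation.

(** * Decomposition by type of a real bilinear form and of its Bianchi identity *)

Section TypeParts.
Variables (F : numFieldType) (V : lmodType F) (I : F) (s : V -> V -> V -> F).
Hypothesis I2 : I * I = -1.
Hypothesis s_anti : forall x y z, s x y z = - s y x z.
Hypothesis sI : forall x y z, s x y (I *: z) = I * s x y z.
Hypothesis s_bianchi : forall x y z, s x y z + s y z x + s z x y = 0.

(* The component of [s], in its first two arguments, that is linear ([- I])
   or antilinear ([I]) in each of them, according to [a] and [b]. *)
Definition type_part (a b : F) x y z :=
  s x y z + a * s (I *: x) y z + b * s x (I *: y) z
  + a * b * s (I *: x) (I *: y) z.

Lemma type_part_anti a b x y z : type_part a b x y z = - type_part b a y x z.
Proof.
rewrite /type_part (s_anti x y) (s_anti _ y) (s_anti x) (s_anti (I *: x)).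
by ring.
Qed.

Let bianchi x y z := s x y z + s y z x + s z x y.

(** The part of the Bianchi identity linear in all arguments; the factor 2 arises as [s] is already
    linear in its last one. *)
Lemma type_part20_bianchi x y z : type_part (- I) (- I) x y z
  + type_part (- I) (- I) y z x + type_part (- I) (- I) z x y = 0.
Proof.
apply: two_eq0.
transitivity (bianchi x y z - I * (bianchi (I *: x) y z
    + bianchi x (I *: y) z + bianchi x y (I *: z))
  - (bianchi (I *: x) (I *: y) z + bianchi (I *: x) y (I *: z)
    + bianchi x (I *: y) (I *: z)) + I * bianchi (I *: x) (I *: y) (I *: z)).
  by rewrite /bianchi /type_part !sI; ring: I2.
by rewrite /bianchi !s_bianchi; ring.
Qed.

(** In the part antilinear in [y], the term with [y] in last place drops out. *)
Lemma type_part11_bianchi x y z :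
  type_part (- I) I x y z + type_part I (- I) y z x = 0.
Proof.
apply: two_eq0.
transitivity (bianchi x y z - I * bianchi (I *: x) y z
    + I * bianchi x (I *: y) z - I * bianchi x y (I *: z)
    + bianchi (I *: x) (I *: y) z - bianchi (I *: x) y (I *: z)
    + bianchi x (I *: y) (I *: z) - I * bianchi (I *: x) (I *: y) (I *: z)).
  by rewrite /bianchi /type_part !sI; ring: I2.
by rewrite /bianchi !s_bianchi; ring.
Qed.

(** In the part antilinear in [x] and [y], only the term with [z] last survives. *)
Lemma type_part02_zero x y z : type_part I I x y z = 0.
Proof.
apply: two_eq0.
transitivity (bianchi x y z + I * bianchi (I *: x) y z
    + I * bianchi x (I *: y) z - I * bianchi x y (I *: z)
    - bianchi (I *: x) (I *: y) z + bianchi (I *: x) y (I *: z)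
    + bianchi x (I *: y) (I *: z) + I * bianchi (I *: x) (I *: y) (I *: z)).
  by rewrite /bianchi /type_part !sI; ring: I2.
by rewrite /bianchi !s_bianchi; ring.
Qed.

Lemma type_parts_zero x y z : type_part (- I) (- I) x y z = 0 ->
    type_part (- I) I x y z = 0 -> type_part I (- I) x y z = 0 ->
  [/\ s x y z = 0, s (I *: x) y z = 0, s x (I *: y) z = 0
    & s (I *: x) (I *: y) z = 0].
Proof.
move=> e20 e11 e11'; have e02 := type_part02_zero x y z.
have four (c : F) : 4%:R * c = 0 -> c = 0.
  by move/eqP; rewrite mulf_eq0 pnatr_eq0 => /eqP.
split; apply: four.
- transitivity (type_part (- I) (- I) x y z + type_part (- I) I x y z
    + type_part I (- I) x y z + type_part I I x y z).
    by rewrite /type_part; ring: I2.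
  by rewrite e20 e11 e11' e02 !addr0.
- transitivity (I * (type_part (- I) (- I) x y z + type_part (- I) I x y z
    - type_part I (- I) x y z - type_part I I x y z)).
    by rewrite /type_part; ring: I2.
  by rewrite e20 e11 e11' e02; ring.
- transitivity (I * (type_part (- I) (- I) x y z - type_part (- I) I x y z
    + type_part I (- I) x y z - type_part I I x y z)).
    by rewrite /type_part; ring: I2.
  by rewrite e20 e11 e11' e02; ring.
- transitivity (- type_part (- I) (- I) x y z + type_part (- I) I x y z
    + type_part I (- I) x y z - type_part I I x y z).
    by rewrite /type_part; ring: I2.
  by rewrite e20 e11 e11' e02; ring.
Qed.

End TypeParts.

(** * Real linear maps and their real trace *)

Section RealLinear.
Variable R : realType.
Local Notation C := R[i].
Local Notation I := (0 +i* 1 : C).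

Lemma imag_sqr : I * I = -1.
Proof. by rewrite -expr2 sqr_i. Qed.

Lemma complex_split (c : C) : c = (complex.Re c)%:C + (complex.Im c)%:C * I.
Proof. by rewrite {1}[c]complexE mulrC. Qed.

Lemma scale_imag2 (U : lmodType C) (x : U) : I *: (I *: x) = - x.
Proof. by rewrite scalerA imag_sqr scaleN1r. Qed.

Section Maps.
Variables (U W : lmodType C) (phi : U -> W).
Hypothesis phi_lin : real_linear phi.

Lemma real_linearD x y : phi (x + y) = phi x + phi y.
Proof. by have := phi_lin 1 x y; rewrite !scale1r. Qed.

Lemma real_linear0 : phi 0 = 0.
Proof. by apply: (addrI (phi 0)); rewrite -real_linearD !addr0. Qed.

Lemma real_linearZ (a : R) x : phi (a%:C *: x) = a%:C *: phi x.
Proof. by have := phi_lin a x 0; rewrite real_linear0 !addr0. Qed.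

Lemma real_linearN x : phi (- x) = - phi x.
Proof.
by apply/eqP; rewrite -addr_eq0 -real_linearD addNr real_linear0.
Qed.

Lemma real_linear_scale (c : C) x : phi (c *: x)
  = (complex.Re c)%:C *: phi x + (complex.Im c)%:C *: phi (I *: x).
Proof.
by rewrite {1}(complex_split c) scalerDl real_linearD real_linearZ
  -scalerA real_linearZ.
Qed.

End Maps.

Lemma complex_part_linear n (phi : 'cV[C]_n -> 'cV[C]_n) : real_linear phi ->
  linear (fun x => phi x - I *: phi (I *: x)).
Proof.
move=> phi_lin a x y; have phiD := real_linearD phi_lin.
rewrite scalerDr !phiD scalerA mulrC -scalerA !(real_linear_scale phi_lin a).
rewrite scale_imag2 (real_linearN phi_lin); apply/colP => i.
rewrite !mxE [X in _ = X * _ + _](complex_split a).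
by ring: imag_sqr.
Qed.

Lemma real_linear_eq0 n (W : lmodType C) (phi : 'cV[C]_n -> W) (P : 'M[C]_n) :
    real_linear phi -> P \in unitmx ->
    (forall p, phi (col p P) = 0 /\ phi (I *: col p P) = 0) ->
  forall x, phi x = 0.
Proof.
move=> phi_lin Pu phi0 x.
have phiD := real_linearD phi_lin; have phi00 := real_linear0 phi_lin.
have -> : x = \sum_p (invmx P *m x) p 0 *: col p P.
  rewrite -[LHS](mulKVmx Pu); apply/colP => i; rewrite mxE summxE.
  by apply: eq_bigr => p _; rewrite !mxE mulrC.
rewrite (big_morph phi phiD phi00) big1 // => p _.
by have [e1 e2] := phi0 p; rewrite (real_linear_scale phi_lin) e1 e2 !scaler0 addr0.
Qed.

(** An antilinear map has real trace zero, and a complex linear one has twice the real part of its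
    complex trace; the matrix here is that of twice the complex linear part of [phi], in the basis
    [P]. *)
Lemma real_trace_complex_part n (phi : 'cV[C]_n -> 'cV[C]_n) (P : 'M[C]_n) :
    real_linear phi -> P \in unitmx ->
  real_trace phi = complex.Re (\sum_p
    (invmx P *m (phi (col p P) - I *: phi (I *: col p P))) p 0).
Proof.
move=> phi_lin Pu; have psi_lin := complex_part_linear phi_lin.
set psi := fun x => _ in psi_lin.
pose linpsi : {linear 'cV[C]_n -> 'cV[C]_n} :=
  HB.pack psi (GRing.isLinear.Build _ _ _ _ _ psi_lin).
pose M : 'M[C]_n := \matrix_(i, j) psi (delta_mx j 0) i 0.
have psiE x : psi x = M *m x.
  rewrite -[psi x]/(linpsi x) [in LHS](matrix_sum_delta x) linear_sum.
  apply/colP => i; rewrite summxE mxE; apply: eq_bigr => j _.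
  by rewrite big_ord1 linearZ [LHS]mxE [M _ _]mxE mulrC.
have -> : real_trace phi = complex.Re (\tr M).
  rewrite /real_trace /mxtrace raddf_sum /=; apply: eq_bigr => j _.
  rewrite /M mxE /psi !mxE.
  case: (phi _ j 0) => a b; case: (phi _ j 0) => c d /=.
  by rewrite mul0r mul1r sub0r opprK.
have -> : \tr M = \tr (invmx P *m (M *m P)).
  by rewrite mulmxA mxtrace_mulC mulmxA mulmxV // mul1mx.
congr (complex.Re _); apply: eq_bigr => p _.
rewrite -/(psi _) psiE.
by rewrite colE !mulmxA -colE [RHS]mxE.
Qed.

(** * Vanishing of each type of a Ricci-flat curvature *)

Section CurvatureTypes.
Variables (g : {vspace 'M[C]_27}) (P : 'M[C]_27).
Hypothesis P_unit : P \in unitmx.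
Hypothesis g_inv : forall A, A \in g ->
  exists l, triad_invariant l (entry (invmx P *m A *m P)).
Variable k : 'cV[C]_27 -> 'cV[C]_27 -> 'M[C]_27.
Hypothesis k_curv : in_curvature_module g k.
Hypothesis k_ricci : forall x y, ricci k x y = 0.

Let kDl x x' y : k (x + x') y = k x y + k x' y.
Proof. exact: (real_linearD (curv_linear_l k_curv y)). Qed.

Let kDr x y y' : k x (y + y') = k x y + k x y'.
Proof. exact: (real_linearD (curv_linear_r k_curv x)). Qed.

Lemma curv_anti x y : k x y = - k y x.
Proof.
apply/eqP; rewrite -addr_eq0; have := curv_alternating k_curv (x + y).
by rewrite kDl !kDr !(curv_alternating k_curv) add0r addr0 => ->.
Qed.

Let u (p : nat) : 'cV[C]_27 := col (inord p) P.

Let value r (A : 'M[C]_27) (z : 'cV[C]_27) := (invmx P *m (A *m z)) r 0.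

Let valueD r A B z : value r (A + B) z = value r A z + value r B z.
Proof. by rewrite /value mulmxDl mulmxDr mxE. Qed.

Let valueZ r a A z : value r (a *: A) z = a * value r A z.
Proof. by rewrite /value -scalemxAl -scalemxAr mxE. Qed.

Let s r x y z := value r (k x y) z.

Let s_anti r x y z : s r x y z = - s r y x z.
Proof. by rewrite /s curv_anti -scaleN1r valueZ mulN1r. Qed.

Let sI r x y z : s r x y (I *: z) = I * s r x y z.
Proof. by rewrite /s /value -!scalemxAr mxE. Qed.

Let s_bianchi r x y z : s r x y z + s r y z x + s r z x y = 0.
Proof.
have := congr1 (mulmx (invmx P)) (curv_bianchi k_curv x y z).
rewrite !mulmxDr mulmx0 => /colP/(_ r).
by rewrite [RHS]mxE [LHS]mxE [X in X + _]mxE.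
Qed.

Let part a b p q r w := type_part I (s (inord r)) a b (u p) (u q) (u w).

(** As [g] is a complex subspace, the part is again the matrix of an element of [g]. *)
Lemma part_triad_invariant a b p q :
  exists l, triad_invariant l (part a b p q).
Proof.
pose A := k (u p) (u q) + a *: k (I *: u p) (u q) + b *: k (u p) (I *: u q)
  + (a * b) *: k (I *: u p) (I *: u q).
have gA : A \in g by rewrite !memvD ?memvZ ?(curv_in k_curv).
have AE r w : entry (invmx P *m A *m P) r w = part a b p q r w.
  rewrite [RHS](_ : _ = value (inord r) A (u w)).
    by rewrite /entry /value /u colE !mulmxA -colE [RHS]mxE.
  by rewrite /A !valueD !valueZ.
by have [l [Z X D]] := g_inv gA; exists l; split=> *; rewrite -!AE; eauto.
Qed.

Let complex_ricci x y :=
  \sum_(p < 27) (s p x (u p) y - I * s p x (I *: u p) y).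

(** The Ricci trace is only the real part; replacing [y] by [I *: y] gives the imaginary part. *)
Lemma complex_ricci0 x y : complex_ricci x y = 0.
Proof.
have re0 y' : complex.Re (complex_ricci x y') = 0.
  rewrite -[RHS](k_ricci x y') /ricci (real_trace_complex_part (P := P)) //.
    congr (complex.Re _); apply: eq_bigr => p _.
    rewrite /s /value /u inord_val mulmxBr -scalemxAr.
    by rewrite [RHS]mxE [X in _ = _ + X]mxE [X in _ = _ - X]mxE.
  move=> a z z'; rewrite (curv_linear_r k_curv) mulmxDl -scalemxAl.
  by [].
have := re0 (I *: y).
have -> : complex_ricci x (I *: y) = I * complex_ricci x y.
  by rewrite mulr_sumr; apply: eq_bigr => p _; rewrite !sI mulrBr.
move: (re0 y); case: (complex_ricci x y) => a b /= ->.
by rewrite mul0r mul1r sub0r => /eqP; rewrite oppr_eq0 => /eqP ->.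
Qed.

Lemma ricci20 p y : \sum_(z < 27) part (- I) (- I) p z z y = 0.
Proof.
transitivity (complex_ricci (u p) (u y) - I * complex_ricci (I *: u p) (u y)).
  rewrite mulr_sumr -sumrB; apply: eq_bigr => z _.
  rewrite /part /type_part inord_val.
  move: (s _ _ _ _) (s _ _ _ _) (s _ _ _ _) (s _ _ _ _) => c1 c2 c3 c4.
  by move: imag_sqr; move: I => J J2; ring: J2.
by rewrite !complex_ricci0 mulr0 subr0.
Qed.

Lemma ricci11 p y : \sum_(z < 27) part I (- I) p z z y = 0.
Proof.
transitivity (complex_ricci (u p) (u y) + I * complex_ricci (I *: u p) (u y)).
  rewrite mulr_sumr -big_split; apply: eq_bigr => z _ /=.
  rewrite /part /type_part inord_val.
  move: (s _ _ _ _) (s _ _ _ _) (s _ _ _ _) (s _ _ _ _) => c1 c2 c3 c4.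
  by move: imag_sqr; move: I => J J2; ring: J2.
by rewrite !complex_ricci0 mulr0 addr0.
Qed.

Lemma part_anti a b p q r w : part a b p q r w = - part b a q p r w.
Proof. exact: type_part_anti. Qed.

Lemma part20_zero (p q r w : 'I_27) : part (- I) (- I) p q r w = 0.
Proof.
apply: (ricci_flat_zero (K := part (- I) (- I))) => //.
- exact: part_anti.
- by move=> *; apply: type_part20_bianchi imag_sqr _ _ _ _ _.
- by move=> *; apply: part_triad_invariant.
- exact: ricci20.
Qed.

Lemma part11_zero (p q r w : 'I_27) : part (- I) I p q r w = 0.
Proof.
pose T p r w := part (- I) I p q r w.
have T_sym a b c : T a b c = T c b a.
  have := type_part11_bianchi imag_sqr (sI (inord b)) (s_bianchi (inord b))
    (u a) (u q) (u c).
  by rewrite -/(part I (- I) q c b a) part_anti => /subr0_eq.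
apply: (prolongation_trace_free (T := T)) => // a.
have [l Tl] := part_triad_invariant (- I) I a q.
suff <- : l = 0 by [].
(* By symmetry of [T], the trace of [T a] is minus a Ricci sum of the part of opposite type. *)
have := trace_triad_invariant Tl; rewrite -/(T a).
rewrite (eq_bigr (fun z : 'I_27 => - part I (- I) q z z a)) => [|z _].
  by rewrite sumrN ricci11 oppr0 => /esym/eqP; rewrite mulf_eq0 pnatr_eq0 => /eqP.
by rewrite -[LHS]/(T a z z) T_sym; apply: part_anti.
Qed.

Lemma curv_zero_on_basis (p q : 'I_27) : [/\ k (u p) (u q) = 0,
  k (I *: u p) (u q) = 0, k (u p) (I *: u q) = 0
  & k (I *: u p) (I *: u q) = 0].
Proof.
have value0 A : (forall r w : 'I_27, value r A (u w) = 0) -> A = 0.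
  move=> A0; have AP : invmx P *m (A *m P) = 0.
    apply/matrixP => r w; rewrite [RHS]mxE -(A0 r w) /value /u inord_val.
    by rewrite colE !mulmxA -colE [RHS]mxE.
  by rewrite -[A](mulmxK P_unit) -[A *m P](mulKVmx P_unit) AP mulmx0 mul0mx.
have parts (r w : 'I_27) : [/\ s r (u p) (u q) (u w) = 0,
    s r (I *: u p) (u q) (u w) = 0, s r (u p) (I *: u q) (u w) = 0
    & s r (I *: u p) (I *: u q) (u w) = 0].
  have := part20_zero p q r w; have := part11_zero p q r w.
  have : part I (- I) p q r w = 0.
    by rewrite part_anti part11_zero oppr0.
  rewrite /part inord_val => e11' e11 e20.
  exact: (type_parts_zero imag_sqr (sI r) (s_bianchi r)).
split; apply: value0 => r w; have [e1 e2 e3 e4] := parts r w.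
- exact: e1.
- exact: e2.
- exact: e3.
- exact: e4.
Qed.

Lemma ricci_flat_curvature_zero x y : k x y = 0.
Proof.
have zero_on_basis (p q : 'I_27) := curv_zero_on_basis p q.
rewrite /u in zero_on_basis.
have col0 (q : 'I_27) x' : k x' (col q P) = 0 /\ k x' (I *: col q P) = 0.
  split; apply: (real_linear_eq0 (curv_linear_l k_curv _) P_unit) => p;
    by have := zero_on_basis p q; rewrite !inord_val => -[].
exact: (real_linear_eq0 (curv_linear_r k_curv x) P_unit).
Qed.

End CurvatureTypes.

End RealLinear.

(** * Real linearity of the Ricci trace, and the isomorphism from its zero kernel *)

Section RicciTraceIso.
Variables (R : realType) (n : nat) (g : {vspace 'M[R[i]]_n}).
Local Notation C := R[i].

Lemma in_curvature_module_comb (a : R) k1 k2 : in_curvature_module g k1 ->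
  in_curvature_module g k2 ->
  in_curvature_module g (fun x y => a%:C *: k1 x y + k2 x y).
Proof.
move=> [l1 r1 a1 g1 b1] [l2 r2 a2 g2 b2].
have comb (U W : lmodType C) (f1 f2 : U -> W) : real_linear f1 ->
    real_linear f2 -> real_linear (fun x => a%:C *: f1 x + f2 x).
  move=> f1l f2l c x y; rewrite f1l f2l !scalerDr !scalerA [a%:C * _]mulrC.
  by rewrite addrACA.
split=> [y|x|x|x y|x y z].
- by apply: comb; [apply: l1 | apply: l2].
- by apply: comb; [apply: r1 | apply: r2].
- by rewrite a1 a2 scaler0 addr0.
- by rewrite memvD // memvZ.
- transitivity (a%:C *: (k1 x y *m z + k1 y z *m x + k1 z x *m y)
      + (k2 x y *m z + k2 y z *m x + k2 z x *m y)).
    rewrite !mulmxDl -!scalemxAl !scalerDr [RHS]addrACA.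
    by rewrite [X in _ = X + _]addrACA.
  by rewrite b1 b2 scaler0 addr0.
Qed.

Lemma ricci_comb (a : R) (k1 k2 : 'cV[C]_n -> 'cV[C]_n -> 'M[C]_n) x y :
  ricci (fun x y => a%:C *: k1 x y + k2 x y) x y
  = a * ricci k1 x y + ricci k2 x y.
Proof.
rewrite /ricci /real_trace mulr_sumr -big_split; apply: eq_bigr => j _ /=.
have entryD (z z' : 'cV[C]_n) : (a%:C *: z + z') j 0 = a%:C * z j 0 + z' j 0.
  by rewrite !mxE.
rewrite !mulmxDl -!scalemxAl !entryD.
case: ((_ *m _) j 0) => a1 b1; case: ((_ *m _) j 0) => a2 b2.
case: ((_ *m _) j 0) => a3 b3; case: ((_ *m _) j 0) => a4 b4 /=.
by ring.
Qed.

Lemma is_ricci_type_iso : is_ricci_type g -> ricci_trace_iso g.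
Proof.
move=> g_ricci; split.
- move=> a k1 k2 K1 K2; split; first exact: in_curvature_module_comb.
  by move=> x y; apply: ricci_comb.
- by move=> k Kk; exists k.
- move=> k1 k2 K1 K2 ric12 x y.
  have : (-1)%:C *: k1 x y + k2 x y = 0.
    apply: (g_ricci _ (in_curvature_module_comb (-1) K1 K2)) => x' y'.
    by rewrite ricci_comb mulN1r ric12 addNr.
  by rewrite rmorphN1 scaleN1r addrC => /subr0_eq/esym.
- by move=> b [k Kk bk]; exists k => // x y; rewrite bk.
Qed.

End RicciTraceIso.

Theorem theorem7p3 (R : realType)
    (L : vectType R[i]) (br : L -> L -> L) (e f h : 'I_6 -> L)
    (rho : 'Hom(L, 'M[R[i]]_27))
    (L_lie : is_lie_bracket br)
    (L_simple : is_simple_lie br)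
    (L_e6 : is_e6_chevalley_system br e f h)
    (rho_standard : is_e6_standard_rep br e h rho) :
  is_ricci_type (scalars_plus_image rho) /\
  ricci_trace_iso (scalars_plus_image rho).
Proof.
have [rho_rep _ [v v0 hw]] := rho_standard.
have hv i : rho (h i) *m v = (i == ord0)%:R *: v by have [] := hw i.
suff g_ricci : is_ricci_type (scalars_plus_image rho).
  by split=> //; apply: is_ricci_type_iso.
move=> k k_curv k_ricci.
apply: (ricci_flat_curvature_zero
          (e6_basis_unit L_e6 rho_rep v0 hv) _ k_curv k_ricci) => A.
exact: (scalars_plus_image_triad_invariant L_e6 rho_rep v0 hv).
Qed.
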